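(* There is a polynomial-time reduction from the reachability problem for vector addition systems to the problem $\mathrm{LinRF}_\rho(\mathbb{Z})$ restricted to loops with a partially-specified initial state.
   Context: A vector addition system (VAS) of dimension $n$ is given by displacement vectors $\vec v_1,\dots,\vec v_m\in\mathbb{Z}^n$ (in binary); its states are vectors in $\mathbb{N}^n$ and a step goes from $\vec x$ to $\vec x+\vec v_i$ for some $i$, provided $\vec x+\vec v_i\ge \vec 0$. The VAS reachability problem: given a VAS and $\vec s,\vec t\in\mathbb{N}^n$, is $\vec t$ reachable from $\vec s$ by a finite sequence of steps? A single-path linear-constraint loop with precondition over variables $\vec{x}=(x_1,\dots,x_n)^T$ has the form $C\vec{x}\le\vec{c};\ \mathit{while}~(B\vec{x}\le\vec{b})~\mathit{do}~A\binom{\vec{x}}{\vec{x}'}\le\vec{a}$, with integer matrices and vectors. Over the integers, states range over $\mathbb{Z}^n$; initial states are integer points with $C\vec x\le\vec c$; a transition is an integer pair $(\vec x,\vec x')$ with $B\vec x\le\vec b$ and $A\binom{\vec x}{\vec x'}\le\vec a$; a reachable transition is one occurring in some computation starting at an initial state. A partially-specified initial state means the precondition has the form $\bigwedge_{i\in S} x_i=d_i$. $\mathrm{LinRF}_\rho(\mathbb{Z})$ asks whether there is an affine $\rho(\vec x)=\vec\lambda\cdot\vec x+\lambda_0$ with rational coefficients such that every reachable transition $(\vec x,\vec x')$ satisfies $\rho(\vec x)\ge0$ and $\rho(\vec x)-\rho(\vec x')\ge1$. *)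

(* Defs.v *)
From Stdlib Require Import Relation_Operators.
From HB Require Import structures.
From mathcomp Require Import all_boot all_order all_algebra.

Set Implicit Arguments.
Unset Strict Implicit.
Unset Printing Implicit Defensive.

Import Order.TTheory GRing.Theory Num.Theory.

Inductive move := Left | Stay | Right.

Section Tape.
Variable cell : Type.

(* A two-way infinite tape, blank outside a finite zone; [lcells] is listed
   from the head outwards. *)
Record tape := Tape
  { lcells : seq (option cell); cur : option cell; rcells : seq (option cell) }.

Definition tape_of (w : seq cell) : tape :=
  if w is a :: w' then Tape [::] (Some a) (map Some w') else Tape [::] None [::].

Definition write (a : option cell) (t : tape) : tape :=
  Tape (lcells t) a (rcells t).

Definition shift (d : move) (t : tape) : tape :=
  match d with
  | Left => Tape (behead (lcells t)) (head None (lcells t)) (cur t :: rcells t)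
  | Stay => t
  | Right => Tape (cur t :: lcells t) (head None (rcells t)) (behead (rcells t))
  end.

(* From the head rightwards, the tape contains [w] and then only blanks. *)
Definition tape_reads (t : tape) (w : seq cell) : Prop :=
  exists k : nat, cur t :: rcells t = map Some w ++ nseq k None.

End Tape.

(* The machine has [ntapes.+1] tapes; its tape alphabet consists of the symbols
   of [Sigma], finitely many work symbols, and the blank [None]. *)
Record TM (Sigma : finType) := MkTM {
  ntapes : nat;
  work : finType;
  state : finType;
  start : state;
  halting : pred state;
  delta : state -> {ffun 'I_ntapes.+1 -> option (Sigma + work)} ->
          state * {ffun 'I_ntapes.+1 -> option (Sigma + work) * move}
}.

Section Run.
Variables (Sigma : finType) (M : TM Sigma).

Record config := Config {
  cstate : state M;
  ctapes : {ffun 'I_(ntapes M).+1 -> tape (Sigma + work M)}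
}.

Definition step (c : config) : config :=
  if halting (cstate c) then c else
  let: (q, act) := delta (cstate c) [ffun i => cur (ctapes c i)] in
  Config q [ffun i => shift (act i).2 (write (act i).1 (ctapes c i))].

(* The input is on the first tape, the other tapes are blank. *)
Definition init (w : seq Sigma) : config :=
  Config (start M)
    [ffun i => tape_of (if i == ord0 then map inl w else [::])].

(* The output is read on the last tape. *)
Definition outputs_within (w : seq Sigma) (T : nat) (v : seq Sigma) : Prop :=
  let c := iter T step (init w) in
  halting (cstate c) /\ tape_reads (ctapes c ord_max) (map inl v).

End Run.

Definition poly_time_computable (Sigma : finType) (X Y : Type)
    (encX : X -> seq Sigma) (encY : Y -> seq Sigma) (f : X -> Y) : Prop :=
  exists (M : TM Sigma) (c d : nat), forall x : X,
    outputs_within M (encX x) (c * size (encX x) ^ d + c) (encY (f x)).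

Definition symbol : finType := (bool + bool)%type.
Definition digit (b : bool) : symbol := inl b.
Definition minus : symbol := inr false.
Definition stop : symbol := inr true.

(* Least significant digit first; [up_log 2 n.+1] is the bit length of [n]. *)
Definition bits (n : nat) : seq bool :=
  mkseq (fun i => odd (n %/ 2 ^ i)) (up_log 2 n.+1).

Definition enc_nat (n : nat) : seq symbol := rcons (map digit (bits n)) stop.

Definition enc_int (z : int) : seq symbol :=
  match z with
  | Posz n => enc_nat n
  | Negz n => minus :: enc_nat n.+1
  end.

Definition enc_mx (p q : nat) (A : 'M[int]_(p, q)) : seq symbol :=
  flatten [seq enc_int (A i j) | i <- enum 'I_p, j <- enum 'I_q].

Local Open Scope ring_scope.

Record vas_instance := VasInstance {
  vdim : nat;
  vnum : nat;
  vdisp : 'M[int]_(vnum, vdim);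
  vsrc : 'rV[nat]_vdim;
  vtgt : 'rV[nat]_vdim
}.

Definition enc_vas (I : vas_instance) : seq symbol :=
  enc_nat (vdim I) ++ enc_nat (vnum I) ++ enc_mx (vdisp I) ++
  enc_mx (map_mx Posz (vsrc I)) ++ enc_mx (map_mx Posz (vtgt I)).

(* The condition x + v_i >= 0 is carried by the type of the target state. *)
Definition vas_step (n m : nat) (V : 'M[int]_(m, n)) (x x' : 'rV[nat]_n) : Prop :=
  exists i : 'I_m, map_mx Posz x' = map_mx Posz x + row i V.

Definition vas_reachable (I : vas_instance) : Prop :=
  clos_refl_trans _ (vas_step (vdisp I)) (vsrc I) (vtgt I).

Record loop := Loop {
  ldim : nat;
  npre : nat; preM : 'M[int]_(npre, ldim); preV : 'cV[int]_npre;
  ngrd : nat; grdM : 'M[int]_(ngrd, ldim); grdV : 'cV[int]_ngrd;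
  nupd : nat; updM : 'M[int]_(nupd, ldim + ldim); updV : 'cV[int]_nupd
}.

Definition enc_loop (L : loop) : seq symbol :=
  enc_nat (ldim L) ++
  enc_nat (npre L) ++ enc_mx (preM L) ++ enc_mx (preV L) ++
  enc_nat (ngrd L) ++ enc_mx (grdM L) ++ enc_mx (grdV L) ++
  enc_nat (nupd L) ++ enc_mx (updM L) ++ enc_mx (updV L).

Definition lecv (k : nat) (u v : 'cV[int]_k) : Prop :=
  forall i, u i 0 <= v i 0.

Section LoopSemantics.
Variable L : loop.

Definition initial (x : 'cV[int]_(ldim L)) : Prop :=
  lecv (preM L *m x) (preV L).

Definition transition (x x' : 'cV[int]_(ldim L)) : Prop :=
  lecv (grdM L *m x) (grdV L) /\ lecv (updM L *m col_mx x x') (updV L).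

Definition reachable_transition (x x' : 'cV[int]_(ldim L)) : Prop :=
  (exists2 x0, initial x0 & clos_refl_trans _ transition x0 x) /\
  transition x x'.

Definition affine (lam : 'rV[rat]_(ldim L)) (lam0 : rat)
    (x : 'cV[int]_(ldim L)) : rat :=
  \sum_i lam 0 i * (x i 0)%:~R + lam0.

Definition has_LinRF : Prop :=
  exists (lam : 'rV[rat]_(ldim L)) (lam0 : rat), forall x x',
    reachable_transition x x' ->
    0 <= affine lam lam0 x /\ 1 <= affine lam lam0 x - affine lam lam0 x'.

(* The precondition is literally the conjunction of the equations x_i = d_i,
   i in S, each written as the two inequalities x_i <= d_i and - x_i <= - d_i;
   the order and repetition of the rows are irrelevant. *)
Definition partially_specified : Prop :=
  exists (S : {set 'I_(ldim L)}) (d : 'I_(ldim L) -> int),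
    let le_row r i := row r (preM L) = delta_mx 0 i /\ preV L r 0 = d i in
    let ge_row r i := row r (preM L) = - delta_mx 0 i /\ preV L r 0 = - d i in
    (forall r, exists2 i, i \in S & le_row r i \/ ge_row r i) /\
    (forall i, i \in S -> (exists r, le_row r i) /\ (exists r, ge_row r i)).

End LoopSemantics.

(* Main.v *)
Require Import Defs.
From Stdlib Require Import Relation_Operators Operators_Properties Classical_Prop.
From mathcomp Require Import all_boot all_order all_algebra.
From mathcomp Require Import zify ring.

(* The loop keeps the Parikh vector Y of the fired displacements, together with
   s = 1 and t in {0, -1}, so that x = V^T Y + s * source + t * target is the
   current marking, minus the target once t = -1.  A step increments at most
   one entry of Y, requires x >= 0, and lowers a counter k >= 0 by at least
   every x_j and by at least 1 + t.  If the target is reachable, then for a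
   suitable (unspecified) initial k the loop reaches a state with x = 0 and
   t = -1, where it can idle forever, so no ranking function exists.
   Otherwise every reachable transition lowers k by at least 1, and k itself
   is a ranking function.  Withdrawing the target early, or putting it back,
   is harmless because x + target >= x.

   The matrices consist of the columns of V and fixed patterns, which a
   multi-tape Turing machine using its tapes as stacks writes with loops over
   unary copies of the two dimensions. *)

Set Implicit Arguments.
Unset Strict Implicit.
Unset Printing Implicit Defensive.
Import Order.TTheory GRing.Theory Num.Theory.

(** * Stack programs and their Turing machines *)

(** The obstacle is that the body of a single-path loop is one conjunction of linear inequalities,
    so the choice of a displacement cannot be written as a disjunction. Storing [Y] instead of the
    marking turns that choice into [Y <= Y'] and a bound 1 on the growth of the sum, which is exact
    over the integers. A vector addition system may run forever without meeting the target, so every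
    loop run that does not witness reachability must be made to stop. The counter [k] does this. Its
    free initial value can pay for any finite run, and requiring [k - k' >= x_j] acts as a zero
    test: once [t = -1], a step that keeps [k] constant forces [x = 0]. Since [s] and [t] are
    variables, source and target enter as coefficients, just like the displacements. The machine
    therefore only copies input numbers, possibly negated, and does arithmetic on the dimensions
    alone. These are given in binary, but in positive dimension the input lists all [(m + 2) * n]
    entries, so unary copies of them have polynomial length. *)

Section StackMachines.
Variables (Sigma : finType) (k : nat).

(** The work alphabet is instantiated with [void], so every nonblank cell is an input symbol. *)
Definition cell : finType := (Sigma + void)%type.
Definition tapes := {ffun 'I_k.+1 -> tape cell}.
Definition reads := {ffun 'I_k.+1 -> option cell}.
Definition action := {ffun 'I_k.+1 -> option cell * move}.

(** Successor [None] is the exit. It is a transition rather than a state, so that composition can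
    redirect it. *)
Record prog := Prog {
  pstate : finType;
  pstart : pstate;
  pnext : pstate -> reads -> option pstate * action
}.

Definition heads (T : tapes) : reads := [ffun i => cur (T i)].

Definition act_on (a : action) (T : tapes) : tapes :=
  [ffun i => shift (a i).2 (write (a i).1 (T i))].

Inductive runs (p : prog) : pstate p -> tapes -> nat -> tapes -> Prop :=
| runs_exit q T a : pnext q (heads T) = (None, a) -> runs q T 1 (act_on a T)
| runs_next q q' T a n T' : pnext q (heads T) = (Some q', a) ->
    runs q' (act_on a T) n T' -> runs q T n.+1 T'.

(** The one simulation argument behind [Seq] and [PopLoop]: the exit of [p] becomes an ordinary step
    to [e], or stays an exit, so running times add up exactly. *)
Lemma runs_embed (p p' : prog) (h : pstate p -> pstate p') (e : option (pstate p'))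
    q T n T' :
  (forall q r, pnext (h q) r =
     (if (pnext q r).1 is Some q' then Some (h q') else e, (pnext q r).2)) ->
  runs q T n T' ->
  match e with
  | None => runs (h q) T n T'
  | Some q2 => forall n2 T2, runs q2 T' n2 T2 -> runs (h q) T (n + n2) T2
  end.
Proof.
move=> Hh; elim=> {q T n T'} [q T a E|q q' T a n T' E _ IH].
  case: e Hh => [q2|] Hh; last by apply: runs_exit; rewrite Hh E.
  by move=> n2 T2 R; apply: (runs_next (a := a)) R; rewrite Hh E.
case: e Hh IH => [q2|] Hh IH.
  move=> n2 T2 R; rewrite addSn; apply: (runs_next (q' := h q') (a := a)).
    by rewrite Hh E.
  exact: IH.
by apply: (runs_next (q' := h q') (a := a)) IH; rewrite Hh E.
Qed.

Definition nop (r : reads) : action := [ffun j => (r j, Stay)].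

Definition Skip : prog := @Prog unit tt (fun _ r => (None, nop r)).

(** Two steps, because a machine step writes before it moves. *)
Definition Push (i : 'I_k.+1) (a : Sigma) : prog :=
  @Prog bool false (fun q r =>
    if q then (None, [ffun j : 'I__ => (if j == i then Some (inl a) else r j, Stay)])
    else (Some true, [ffun j : 'I__ => (r j, if j == i then Left else Stay)])).

Definition Seq (p1 p2 : prog) : prog :=
  @Prog (pstate p1 + pstate p2)%type (inl (pstart p1)) (fun q r =>
    match q with
    | inl q1 => let: (o, a) := pnext q1 r in
        (Some (if o is Some q' then inl q' else inr (pstart p2)), a)
    | inr q2 => let: (o, a) := pnext q2 r in (omap inr o, a)
    end).

(* Pops stack [i] until it is empty or a symbol outside [cont] has been
   popped; every popped symbol [a] triggers [body a]. *)
Definition PopLoop (i : 'I_k.+1) (cont : pred Sigma) (body : Sigma -> prog) : prog :=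
  @Prog (option {a : Sigma & pstate (body a)}) None (fun q r =>
    match q with
    | None =>
        match r i with
        | Some (inl a) =>
            (Some (Some (Tagged (fun a => pstate (body a)) (pstart (body a)))),
             [ffun j : 'I__ => (r j, if j == i then Right else Stay)])
        | _ => (None, nop r)
        end
    | Some (existT a q1) => let: (o, act) := pnext q1 r in
        (if o is Some q' then Some (Some (Tagged (fun a => pstate (body a)) q'))
         else if cont a then Some None else None, act)
    end).

Notation stacks := (seq (seq Sigma)).

(* A stack is what [tape_reads] sees, with its top under the head; whatever lies
   left of the head is overwritten by later pushes. *)
Definition holds (s : stacks) (T : tapes) : Prop :=
  forall i : 'I_k.+1, tape_reads (T i) (map inl (nth [::] s i)).

(** Total correctness with a time bound; stacks beyond the end of the list count as empty. *)
Definition hoare (s : stacks) (p : prog) (n : nat) (s' : stacks) : Prop :=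
  forall T, holds s T -> exists n' T',
    [/\ n' <= n, runs (pstart p) T n' T' & holds s' T'].

Lemma write_cur (t : tape cell) : write (cur t) t = t.
Proof. by case: t. Qed.

Lemma act_on_nop T : act_on (nop (heads T)) T = T.
Proof. by apply/ffunP=> i; rewrite ?ffunE /= write_cur. Qed.

Lemma hoare_le s p n n' s' : n <= n' -> hoare s p n s' -> hoare s p n' s'.
Proof.
move=> le H T /H [m [T' [le' R h]]]; exists m, T'; split=> //.
exact: leq_trans le' le.
Qed.

Lemma hoare_skip s : hoare s Skip 1 s.
Proof.
move=> T hT; exists 1, T; split=> //.
by rewrite -{2}[T]act_on_nop; apply: runs_exit.
Qed.

Lemma hoare_seq s p1 n1 s1 p2 n2 s2 :
  hoare s p1 n1 s1 -> hoare s1 p2 n2 s2 -> hoare s (Seq p1 p2) (n1 + n2) s2.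
Proof.
move=> H1 H2 T /H1 [m1 [T1 [le1 R1 /H2 [m2 [T2 [le2 R2 h2]]]]]].
exists (m1 + m2), T2; split=> //; first exact: leq_add.
have := @runs_embed p1 (Seq p1 p2) inl (Some (inr (pstart p2))) _ _ _ _ _ R1.
move=> /=; apply; first by move=> q r; case: (pnext q r) => [[]].
have := @runs_embed p2 (Seq p1 p2) inr None _ _ _ _ _ R2.
by apply=> q r /=; case: (pnext q r) => [[]].
Qed.

Lemma hoare_push (i : 'I_k.+1) a s :
  hoare s (Push i a) 2 (set_nth [::] s i (a :: nth [::] s i)).
Proof.
move=> T hT.
pose a1 : action := [ffun j => (heads T j, if j == i then Left else Stay)].
pose T1 := act_on a1 T.
pose a2 : action := [ffun j => (if j == i then Some (inl a) else heads T1 j, Stay)].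
exists 2, (act_on a2 T1); split=> //.
  apply: (@runs_next (Push i a) _ true _ a1) => //.
  exact: (@runs_exit (Push i a) _ _ a2).
move=> j; rewrite nth_set_nth /= val_eqE ?ffunE /= ?ffunE /= ?ffunE /=.
have [->|ne] := eqVneq j i; last by rewrite /= !write_cur; apply: hT.
have [z hz] := hT i; exists z; rewrite /= -hz.
by case: (T i).
Qed.

Definition pop_act i (r : reads) : action :=
  [ffun j => (r j, if j == i then Right else Stay)].

Lemma holds_pop s T (i : 'I_k.+1) a l :
  nth [::] s i = a :: l -> holds s T ->
  heads T i = Some (inl a) /\
  holds (set_nth [::] s i l) (act_on (pop_act i (heads T)) T).
Proof.
move=> E hT; have := hT i; rewrite E => -[z hz]; split.
  by rewrite ffunE; case: hz.
move=> j; rewrite nth_set_nth /= val_eqE ?ffunE /= ?ffunE /= write_cur.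
have [->|ne] := eqVneq j i; last exact: hT.
(* Moving right past the last stored cell creates a blank, so the padding grows from 0 to 1. *)
case: (T i) hz => lc c rc /= [_ Erc]; exists (if rc is [::] then 1 else z).
by case: rc Erc => [|d rc] //=; case: l {E}.
Qed.

Lemma heads_empty s T (i : 'I_k.+1) :
  nth [::] s i = [::] -> holds s T -> heads T i = None.
Proof.
move=> E /(_ i) [z]; rewrite E ffunE.
by case: (T i) => /= lc c rc; case: z => //= z [].
Qed.

Lemma hoare_loop_nil (i : 'I_k.+1) cont body s :
  nth [::] s i = [::] -> hoare s (PopLoop i cont body) 1 s.
Proof.
move=> E T hT; exists 1, T; split=> //.
rewrite -{2}[T]act_on_nop; apply: runs_exit => /=.
by rewrite (heads_empty E hT).
Qed.

Lemma hoare_loop_stop (i : 'I_k.+1) (cont : pred Sigma) (body : Sigma -> prog) s a l n s' :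
  nth [::] s i = a :: l -> ~~ cont a ->
  hoare (set_nth [::] s i l) (body a) n s' ->
  hoare s (PopLoop i cont body) n.+1 s'.
Proof.
move=> E ca H T hT; have [hd hT1] := holds_pop E hT.
have [m [T' [le R h']]] := H _ hT1.
exists m.+1, T'; split=> //.
apply: (@runs_next (PopLoop i cont body) _
  (Some (Tagged (fun a => pstate (body a)) (pstart (body a)))) _ (pop_act i (heads T))).
  by rewrite /= hd.
apply: (@runs_embed _ (PopLoop i cont body)
  (fun q => Some (Tagged (fun a => pstate (body a)) q)) None _ _ _ _ _ R).
by move=> q r /=; case: (pnext q r) => [[]] //=; rewrite (negPf ca).
Qed.

Lemma hoare_loop_cont (i : 'I_k.+1) (cont : pred Sigma) (body : Sigma -> prog) s a l n s' n' s'' :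
  nth [::] s i = a :: l -> cont a ->
  hoare (set_nth [::] s i l) (body a) n s' ->
  hoare s' (PopLoop i cont body) n' s'' ->
  hoare s (PopLoop i cont body) (n + n').+1 s''.
Proof.
move=> E ca H H' T hT; have [hd hT1] := holds_pop E hT.
have [m [T' [le R /H' [m' [T'' [le' R' h'']]]]]] := H _ hT1.
exists (m + m').+1, T''; split=> //; first by rewrite ltnS leq_add.
apply: (@runs_next (PopLoop i cont body) _
  (Some (Tagged (fun a => pstate (body a)) (pstart (body a)))) _ (pop_act i (heads T))).
  by rewrite /= hd.
apply: (@runs_embed _ (PopLoop i cont body)
  (fun q => Some (Tagged (fun a => pstate (body a)) q)) (Some None) _ _ _ _ _ R) => //.
by move=> q r /=; case: (pnext q r) => [[]] //=; rewrite ca.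
Qed.

(** Only a left move lengthens the right part of a tape, and by one cell. Output lengths are thus
    bounded by running times, without being computed. *)
Lemma runs_size p q T n T' i : @runs p q T n T' ->
  size (rcells (T' i)) <= size (rcells (T i)) + n.
Proof.
have act a (T1 : tapes) : size (rcells (act_on a T1 i)) <= size (rcells (T1 i)) + 1.
  by rewrite ffunE; case: (a i) => c [] /=; rewrite ?size_behead; lia.
elim=> {q T n T'} [q T a _|q q' T a n T' _ _ IH]; first exact: act.
by have := act a T; lia.
Qed.

Lemma hoare_size s p n s' (i : 'I_k.+1) : hoare s p n s' ->
  size (nth [::] s' i) <= size (nth [::] s i) + n + 1.
Proof.
move=> H; pose T : tapes := [ffun j : 'I__ => tape_of (map inl (nth [::] s j))].
have [|n' [T' [le R /(_ i)[z hz]]]] := H T.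
  move=> j; rewrite ffunE; exists (if nth [::] s j is [::] then 1 else 0).
  by case: (nth _ _ _) => //= a l; rewrite cats0.
have := runs_size i R.
have := congr1 size hz; rewrite size_cat !size_map size_nseq ffunE /=.
have : size (rcells (tape_of (map (@inl Sigma void) (nth [::] s i)))) <= size (nth [::] s i).
  by case: (nth _ _ _) => //= a l; rewrite !size_map; apply: leqW.
lia.
Qed.

Section Compile.
Variable p : prog.

Definition machine : TM Sigma :=
  @MkTM Sigma k void (option (pstate p)) (Some (pstart p)) (fun q => q == None)
    (fun q r => if q is Some q1 then pnext q1 r else (None, nop r)).

Lemma runs_iter q T n T' : runs q T n T' ->
  iter n (@step _ machine) (@Config _ machine (Some q) T) =
  @Config _ machine None T'.
Proof.
elim=> {q T n T'} [q T a E|q q' T a n T' E _ IH].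
  by rewrite /= /step /= [LHS](_ : _ = let: (q', act) := pnext q (heads T) in
    @Config _ machine q' (act_on act T)) // E.
rewrite iterSr -IH; congr iter.
by rewrite /step /= [LHS](_ : _ = let: (q', act) := pnext q (heads T) in
    @Config _ machine q' (act_on act T)) // E.
Qed.

Lemma iter_halted n T :
  iter n (@step _ machine) (@Config _ machine None T) = @Config _ machine None T.
Proof. by elim: n => //= n ->. Qed.

(** A halted machine stays put, so any upper bound on the time will do; stack [k] is the last
    tape. *)
Lemma hoare_outputs w n s N v :
  hoare [:: w] p n s -> nth [::] s k = v -> n <= N ->
  @outputs_within _ machine w N v.
Proof.
move=> H Ev le.
pose T0 : tapes := [ffun i => tape_of (if i == ord0 then map inl w else [::])].
have [|m [T' [lem R h]]] := H T0.
  move=> i; rewrite ffunE -val_eqE /=; exists (if nth [::] [:: w] i is [::] then 1 else 0).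
  case: i => [[|i] lti] /=; first by case: (w) => //= a l; rewrite cats0.
  by rewrite nth_nil.
have E : iter N (@step _ machine) (init machine w) = @Config _ machine None T'.
  by rewrite -(subnK (leq_trans lem le)) iterD (runs_iter R) iter_halted.
rewrite /outputs_within E; split=> //.
by rewrite /= -Ev; apply: (h ord_max).
Qed.

End Compile.

End StackMachines.

(** * Polynomial bounds and loop rules *)

(** The positive base [N.+1] makes powers monotone in the exponent, so sums and products can both be
    bounded by adding degrees. *)
Definition poly_bounded (P : nat -> nat) : Prop :=
  exists c d, forall N, P N <= c * N.+1 ^ d.

Lemma poly_const c : poly_bounded (fun _ => c).
Proof. by exists c, 0 => N; rewrite muln1. Qed.

Lemma poly_id : poly_bounded (fun N => N).
Proof. by exists 1, 1 => N; lia. Qed.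

Lemma poly_succ : poly_bounded succn.
Proof. by exists 1, 1 => N; lia. Qed.

Lemma polyD P Q : poly_bounded P -> poly_bounded Q ->
  poly_bounded (fun N => P N + Q N).
Proof.
move=> [c [d hP]] [c' [d' hQ]]; exists (c + c'), (d + d') => N.
rewrite mulnDl; apply: leq_add; [apply: leq_trans (hP N) _|apply: leq_trans (hQ N) _];
  by apply: leq_mul => //; apply: leq_pexp2l => //; lia.
Qed.

Lemma polyM P Q : poly_bounded P -> poly_bounded Q ->
  poly_bounded (fun N => P N * Q N).
Proof.
move=> [c [d hP]] [c' [d' hQ]]; exists (c * c'), (d + d') => N.
by apply: leq_trans (leq_mul (hP N) (hQ N)) _; rewrite expnD mulnACA.
Qed.

Lemma poly_affine P a b : poly_bounded P -> poly_bounded (fun N => P (a * N + b)).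
Proof.
move=> [c [d hP]]; exists (c * (a + b).+1 ^ d), d => N.
apply: leq_trans (hP _) _; rewrite -mulnA -expnMn leq_mul2l; apply/orP; right.
case: d {hP} => // d; rewrite leq_exp2r //; nia.
Qed.

(** For positive [N], [N.+1 <= 2 * N], which costs a factor [2 ^ d]; the additive constant covers
    [N = 0]. *)
Lemma poly_boundedP P : poly_bounded P ->
  exists c d, forall N, P N <= c * N ^ d + c.
Proof.
move=> [c [d hP]]; exists (c * 2 ^ d), d => N.
apply: leq_trans (hP N) _.
case: N => [|N]; first by rewrite exp1n muln1 (leq_trans _ (leq_addl _ _)) // leq_pmulr // expn_gt0.
apply: (@leq_trans (c * 2 ^ d * N.+1 ^ d)); last exact: leq_addr.
rewrite -mulnA leq_mul2l -expnMn; apply/orP; right.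
by case: d {hP} => [|d]; rewrite ?expn0 ?leq_exp2r ?mulnS //; lia.
Qed.

Section Loops.
Variables (Sigma : finType) (k : nat).
Notation stacks := (seq (seq Sigma)).
Notation prog := (prog Sigma k).

(* [F l d]: [l] is left on stack [i], [d] has been popped from it. *)
Definition scans (i : 'I_k.+1) (F : seq Sigma -> seq Sigma -> stacks) : Prop :=
  forall l d, nth [::] (F l d) i = l /\
    forall l', set_nth [::] (F l d) i l' = F l' d.

Lemma hoare_while i (body : Sigma -> prog) F w c : scans i F ->
  (forall d a l, w = d ++ a :: l -> hoare (F l d) (body a) c (F l (rcons d a))) ->
  hoare (F w [::]) (PopLoop i predT body) (size w * c.+1 + 1) (F [::] w).
Proof.
move=> sF H.
suff gen l d : w = d ++ l ->
    hoare (F l d) (PopLoop i predT body) (size l * c.+1 + 1) (F [::] w).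
  exact: gen.
elim: l d => [|a l IH] d E.
  by rewrite E cats0; apply: hoare_loop_nil; apply: (sF _ _).1.
have -> : size (a :: l) * c.+1 + 1 = (c + (size l * c.+1 + 1)).+1 by rewrite /=; lia.
have [E1 E2] := sF (a :: l) d.
apply: (hoare_loop_cont E1) => //; first by rewrite E2; apply: H.
by apply: IH; rewrite E cat_rcons.
Qed.

(** The loop exits through the body run for [stp], hence no extra step for a final test. *)
Lemma hoare_until i stp (body : Sigma -> prog) F w l c : scans i F ->
  stp \notin w ->
  (forall l d a, a \in rcons w stp ->
     hoare (F l d) (body a) c (F l (rcons d a))) ->
  hoare (F (rcons w stp ++ l) [::]) (PopLoop i (predC1 stp) body)
    (size (rcons w stp) * c.+1) (F l (rcons w stp)).
Proof.
move=> sF nw H; rewrite -[rcons w stp in X in hoare _ _ _ X]cat0s.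
elim: w [::] nw H => [|a w IH] d nw H /=.
  have [E1 E2] := sF (stp :: l) d.
  rewrite mul1n; apply: (hoare_loop_stop E1); first by rewrite /= eqxx.
  by rewrite E2 cats1; apply: H; rewrite inE eqxx.
have -> : (size (rcons w stp)).+1 * c.+1 = (c + (size (rcons w stp) * c.+1)).+1 by lia.
have [E1 E2] := sF (a :: rcons w stp ++ l) d.
move: nw; rewrite inE negb_or eq_sym => /andP[ne nw].
apply: (hoare_loop_cont E1) => //; first by rewrite E2; apply: H; rewrite inE eqxx.
by rewrite -cat_rcons; apply: IH => // l' d' b bw; apply: H; rewrite inE bw orbT.
Qed.

Lemma rcons_nseq T n (a : T) : rcons (nseq n a) a = nseq n.+1 a.
Proof. by elim: n => //= n ->. Qed.

Lemma nseq_split (T : eqType) n (a b : T) d l : nseq n a = d ++ b :: l ->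
  [/\ size d < n, d = nseq (size d) a, b = a & l = nseq (n - (size d).+1) a].
Proof.
move=> E; have sz : n = size d + (size l).+1 by rewrite -(size_nseq n a) E size_cat.
have /all_pred1P : nseq n a = nseq (size (nseq n a)) a by rewrite size_nseq.
rewrite E all_cat /= => /and3P[/all_pred1P Ed /eqP Eb /all_pred1P El].
have -> : n - (size d).+1 = size l by lia.
by split=> //; lia.
Qed.

(* Runs [body] once per symbol of stack [i], saving the symbols on stack [j]
   and restoring them at the end. *)
Definition For (i j : 'I_k.+1) (body : prog) : prog :=
  Seq (PopLoop i predT (fun a => Seq body (Push j a)))
      (PopLoop j predT (fun a => Push i a)).

(** Per round: pop, body and push in the first loop, pop and push in the second. Each loop ends with
    one failing test. *)
Definition forT (L c : nat) : nat := L * (c + 6) + 2.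

Lemma hoare_for i j body (F : nat -> seq Sigma -> seq Sigma -> stacks) n a c L :
  (forall q, scans i (F q)) -> (forall q, scans j (fun t r => F q r t)) ->
  n <= L ->
  (forall q, q < n -> hoare (F q (nseq (n - q.+1) a) (nseq q a)) body c
                            (F q.+1 (nseq (n - q.+1) a) (nseq q a))) ->
  hoare (F 0 (nseq n a) [::]) (For i j body) (forT L c) (F n (nseq n a) [::]).
Proof.
move=> si sj le H.
apply: (@hoare_le _ _ _ _ ((n * (c + 2).+1 + 1) + (n * 3 + 1))).
  by rewrite /forT; nia.
apply: (@hoare_seq _ _ _ _ _ (F n [::] (nseq n a))).
  have := @hoare_while i (fun a => Seq body (Push j a))
    (fun l d => F (size d) l d) (nseq n a) (c + 2).
  rewrite !size_nseq; apply; first by move=> l d; apply: si.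
  move=> d b l /nseq_split[lt -> -> ->]; rewrite size_nseq rcons_nseq size_nseq.
  apply: (hoare_seq (H _ lt)).
  have [E1 E2] := sj (size d).+1 (nseq (size d) a) (nseq (n - (size d).+1) a).
  have := @hoare_push _ _ j a (F (size d).+1 (nseq (n - (size d).+1) a) (nseq (size d) a)).
  by rewrite E1 E2.
have := @hoare_while j (fun a => Push i a)
    (fun l d => F n d l) (nseq n a) 2.
rewrite size_nseq; apply; first by move=> l d; apply: sj.
move=> d b l /nseq_split[lt -> -> ->]; rewrite rcons_nseq.
have [E1 E2] := si n (nseq (size d) a) (nseq (n - (size d).+1) a).
by have := @hoare_push _ _ i a (F n (nseq (size d) a) (nseq (n - (size d).+1) a));
  rewrite E1 E2 size_nseq.
Qed.

End Loops.

(** * Binary numerals *)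

Lemma bits_rec n : bits n = if n is 0 then [::] else odd n :: bits n./2.
Proof.
case: n => [|n]; first by rewrite /bits up_log1.
rewrite /bits up_log2S // /mkseq /= expn0 divn1; congr (_ :: _).
rewrite -[1]/(1 + 0) iotaDl -map_comp; apply: eq_map => i /=.
by rewrite expnS divnMA divn2.
Qed.

Fixpoint bits_succ (s : seq bool) : seq bool :=
  match s with
  | true :: s' => false :: bits_succ s'
  | _ => true :: behead s
  end.

Lemma bits_succE n : bits_succ (bits n) = bits n.+1.
Proof.
have [m] := ubnP n; elim: m n => // m IH [|n] lt.
  by rewrite !(bits_rec 0) (bits_rec 1) /= (bits_rec 0).
rewrite (bits_rec n.+1) (bits_rec n.+2) /= negbK uphalf_half.
case: (boolP (odd n)) => o /=; last by rewrite IH //; move: lt; lia.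
by [].
Qed.

Lemma size_bits n : size (bits n) <= n.
Proof.
have [m] := ubnP n; elim: m n => // m IH [|n] lt.
  by rewrite bits_rec.
rewrite bits_rec /=; have := IH (uphalf n); lia.
Qed.

Lemma bits_value n : foldl (fun v (b : bool) => v.*2 + b) 0 (rev (bits n)) = n.
Proof.
rewrite -[rev _]revK foldl_rev revK.
have [m] := ubnP n; elim: m n => // m IH [|n] lt.
  by rewrite bits_rec.
rewrite bits_rec [LHS]/= IH; lia.
Qed.

(** * The program computing the reduction *)

Notation tick := stop.
(* [rX] holds the unread input and [rY] the input already read; [rU], [rW] split
   the dimension in unary, [rM], [rP] the number of displacements; [rB] is a
   binary counter, [rO] the output written so far, last symbol on top, and [rR]
   the final output; [rT] is scratch. *)
Notation program := (prog symbol 9).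
Definition rX : 'I_10 := @Ordinal 10 0 isT.
Definition rU : 'I_10 := @Ordinal 10 1 isT.
Definition rW : 'I_10 := @Ordinal 10 2 isT.
Definition rM : 'I_10 := @Ordinal 10 3 isT.
Definition rP : 'I_10 := @Ordinal 10 4 isT.
Definition rY : 'I_10 := @Ordinal 10 5 isT.
Definition rT : 'I_10 := @Ordinal 10 6 isT.
Definition rB : 'I_10 := @Ordinal 10 7 isT.
Definition rO : 'I_10 := @Ordinal 10 8 isT.
Definition rR : 'I_10 := @Ordinal 10 9 isT.

(* [e] is the text emitted so far. *)
Definition St (x u w m p y t b e : seq symbol) : seq (seq symbol) :=
  [:: x; u; w; m; p; y; t; b; rev e; [::]].

Notation Pushr := (@Push symbol 9).

Definition Do (ps : seq program) : program := foldr (@Seq symbol 9) (@Skip symbol 9) ps.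

Definition emit (w : seq symbol) : program := Do (map (Pushr rO) w).

Definition emitT (w : seq symbol) : nat := 2 * size w + 1.

Lemma hoare_emit w x u v m p y t b e :
  hoare (St x u v m p y t b e) (emit w) (emitT w) (St x u v m p y t b (e ++ w)).
Proof.
rewrite /emitT; elim: w e => [|a w IH] e /=.
  by rewrite cats0; apply: hoare_skip.
rewrite mulnS -addnA.
apply: (hoare_seq (s1 := St x u v m p y t b (rcons e a))).
  by rewrite /St rev_rcons; apply: hoare_push.
by rewrite -cat_rcons; apply: IH.
Qed.

Definition Emits (i j : 'I_10) (w : seq symbol) := For i j (emit w).

Lemma hoare_emits_M n L w x u v p y b e : n <= L ->
  hoare (St x u v (nseq n tick) p y [::] b e) (Emits rM rT w)
    (forT L (emitT w))
    (St x u v (nseq n tick) p y [::] b (e ++ flatten (nseq n w))).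
Proof.
move=> le.
have := @hoare_for _ _ rM rT (emit w)
  (fun q r t => St x u v r p y t b (e ++ flatten (nseq q w))) n tick (emitT w) L.
rewrite cats0; apply=> // q lt.
rewrite -rcons_nseq flatten_rcons catA; exact: hoare_emit.
Qed.


Lemma hoare_emits_P n L w x u v m y b e : n <= L ->
  hoare (St x u v m (nseq n tick) y [::] b e) (Emits rP rT w)
    (forT L (emitT w))
    (St x u v m (nseq n tick) y [::] b (e ++ flatten (nseq n w))).
Proof.
move=> le.
have := @hoare_for _ _ rP rT (emit w)
  (fun q r t => St x u v m r y t b (e ++ flatten (nseq q w))) n tick (emitT w) L.
rewrite cats0; apply=> // q lt.
rewrite -rcons_nseq flatten_rcons catA; exact: hoare_emit.
Qed.

Lemma hoare_emits_U n L w x v m p y b e : n <= L ->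
  hoare (St x (nseq n tick) v m p y [::] b e) (Emits rU rT w)
    (forT L (emitT w))
    (St x (nseq n tick) v m p y [::] b (e ++ flatten (nseq n w))).
Proof.
move=> le.
have := @hoare_for _ _ rU rT (emit w)
  (fun q r t => St x r v m p y t b (e ++ flatten (nseq q w))) n tick (emitT w) L.
rewrite cats0; apply=> // q lt.
rewrite -rcons_nseq flatten_rcons catA; exact: hoare_emit.
Qed.

Lemma hoare_do_cons p ps t t' s1 s2 s3 :
  hoare s1 p t s2 -> hoare s2 (Do ps) t' s3 -> hoare s1 (Do (p :: ps)) (t + t') s3.
Proof. exact: hoare_seq. Qed.

Lemma hoare_do_nil s : hoare s (Do [::]) 1 s.
Proof. exact: hoare_skip. Qed.

(** Carry propagation: the ones on top of [rB] are saved as zeros on [rT]. The first zero, if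
    present, is consumed as well and replaced by a one. *)
Definition inc : program := Do
  [:: PopLoop rB (pred1 (digit true))
        (fun a => if a == digit true then Pushr rT (digit false) else Skip _ _);
      Pushr rB (digit true);
      PopLoop rT predT (fun a => Pushr rB a)].

Definition incT (L : nat) : nat := 6 * L + 6.

(** The defaults of [head] and [behead] make an exhausted numeral behave as if a zero followed. *)
Lemma carry_split s : exists j r,
  [/\ s = nseq j true ++ r, head false r = false &
      bits_succ s = nseq j false ++ true :: behead r].
Proof.
elim: s => [|[] s [j [r [-> hr hs]]]]; first by exists 0, [::].
  by exists j.+1, r; split=> //=; rewrite hs.
by exists 0, (false :: nseq j true ++ r).
Qed.

Lemma hoare_inc n L x u v m p y e : n <= L ->
  hoare (St x u v m p y [::] (map digit (bits n)) e) inc (incT L)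
        (St x u v m p y [::] (map digit (bits n.+1)) e).
Proof.
move=> le; rewrite -bits_succE.
have := leq_trans (size_bits n) le; move: (bits n) => s {le} le.
have [j [r [Es hr ->]]] := carry_split s.
have lej : j <= L by move: le; rewrite Es size_cat size_nseq; lia.
apply: (@hoare_le _ _ _ _ (3 * j + 2 + (2 + (j * 3 + 1 + 1)))).
  by rewrite /incT; lia.
apply: (hoare_do_cons
  (s2 := St x u v m p y (nseq j (digit false)) (map digit (behead r)) e)).
  rewrite Es -[nseq j (digit false)]cats0; clear le lej Es.
  elim: j ([::] : seq symbol) => [|j IH] t; last first.
    rewrite mulnS -addnA -[3 + _]/(2 + _).+1; apply: (hoare_loop_cont (a := digit true)
      (s' := St x u v m p y (digit false :: t) (map digit (nseq j true ++ r)) e)) => //.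
      exact: hoare_push.
    have := IH (digit false :: t).
    by rewrite -cat_rcons rcons_nseq.
  case: r hr => [|[] r] //= _.
    by apply: (@hoare_le _ _ _ _ 1) => //; apply: hoare_loop_nil.
  apply: (hoare_loop_stop (a := digit false)) => //=.
  exact: hoare_skip.
apply: hoare_do_cons; first exact: hoare_push.
apply: hoare_do_cons; last exact: hoare_do_nil.
have := @hoare_while _ _ rT (fun a => Pushr rB a)
  (fun l d => St x u v m p y l (rev d ++ map digit (true :: behead r)) e)
  (nseq j (digit false)) 2.
rewrite size_nseq map_cat map_nseq rev_nseq; apply=> // d a l _.
by rewrite rev_rcons; apply: hoare_push.
Qed.

Definition emit_counter : program := Do
  [:: PopLoop rB predT (fun a => Pushr rO a); emit [:: stop]].

Definition emit_counterT (L : nat) : nat := L * 3 + 1 + (emitT [:: stop] + 1).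

Lemma hoare_emit_counter n L x u v m p y t e : n <= L ->
  hoare (St x u v m p y t (map digit (bits n)) e) emit_counter (emit_counterT L)
        (St x u v m p y t [::] (e ++ enc_nat n)).
Proof.
move=> le; rewrite /enc_nat -cats1 catA.
apply: (hoare_do_cons (s2 := St x u v m p y t [::] (e ++ map digit (bits n)))).
  have := @hoare_while _ _ rB (fun a => Pushr rO a)
    (fun l d => St x u v m p y t l (e ++ d)) (map digit (bits n)) 2.
  rewrite cats0 size_map => H; apply: hoare_le (H _ _) => //.
    by have := size_bits n; nia.
  move=> d a l _; rewrite -rcons_cat /St rev_rcons; exact: hoare_push.
apply: hoare_do_cons; [exact: hoare_emit|exact: hoare_do_nil].
Qed.

(* Horner evaluation of the number at the top of [rX], most significant digit
   first, in unary on [i]; [rW] serves to double the accumulator. *)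
Definition read_unary (i : 'I_10) : program := Do
  [:: PopLoop rX (predC1 stop) (fun a => if a is inl _ then Pushr rT a else Skip _ _);
      PopLoop rT predT (fun a => Do
        [:: PopLoop i predT (fun _ => Do [:: Pushr rW tick; Pushr rW tick]);
            PopLoop rW predT (fun _ => Pushr i tick);
            if a == digit true then Pushr i tick else Skip _ _])].

Definition read_unaryT (L : nat) : nat :=
  L.+1 * 3 + (L * (L * 6 + 1 + (2 * L * 3 + 1 + (2 + 1))).+1 + 1 + 1).

Definition digits_value (d : seq symbol) : nat :=
  foldl (fun v a => v.*2 + (a == digit true)) 0 d.

(** Horner's accumulator never decreases, so intermediate values stay below the number being read;
    this bounds the cost of the doublings. *)
Lemma foldl_value_ge v (d : seq symbol) :
  v <= foldl (fun v a => v.*2 + (a == digit true)) v d.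
Proof. by elim: d v => //= a d IH v; apply: leq_trans (IH _); lia. Qed.

Lemma digits_value_bits n : digits_value (rev (map digit (bits n))) = n.
Proof.
rewrite -[RHS]bits_value -map_rev /digits_value.
by elim: (rev _) 0 => //= b s IH v; rewrite IH; case: b.
Qed.

(** The frame [F] is abstract because both dimensions are read this way, onto different stacks. *)
Lemma hoare_read_unary (i : 'I_10) (F : seq symbol -> seq symbol -> seq symbol ->
    seq symbol -> seq (seq symbol)) n L l :
  (forall w t r, scans rX (fun x _ => F x w t r)) ->
  (forall x t r, scans rW (fun w _ => F x w t r)) ->
  (forall x w r, scans rT (fun t _ => F x w t r)) ->
  (forall x w t, scans i (fun r _ => F x w t r)) ->
  n <= L ->
  hoare (F (enc_nat n ++ l) [::] [::] [::]) (read_unary i) (read_unaryT L)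
        (F l [::] [::] (nseq n tick)).
Proof.
move=> sX sW sT si le; set ds := map digit (bits n).
have szd : size ds <= L by rewrite size_map (leq_trans (size_bits n)).
have push_at (j : 'I_10) (G : seq symbol -> seq symbol -> seq (seq symbol)) r a :
    scans j G -> hoare (G r r) (Pushr j a) 2 (G (a :: r) r).
  move=> /(_ r r)[E1 E2]; have := @hoare_push _ _ j a (G r r).
  by rewrite E1 E2.
apply: (hoare_do_cons (s2 := F l [::] (rev ds) [::])).
  have H := @hoare_until _ _ rX stop
    (fun a => if a is inl _ then Pushr rT a else Skip _ _)
    (fun x d => F x [::] (rev [seq a <- d | a != stop]) [::]) ds l 2.
  apply: hoare_le (leq_mul (_ : _ <= L.+1) (leqnn 3)) _; last first.
    have E : [seq a <- rcons ds stop | a != stop] = ds.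
      rewrite filter_rcons /= /ds; apply/all_filterP.
      by rewrite all_map; apply/allP.
    rewrite -{2}E; apply: H.
    - by move=> x d; apply: sX.
    - by apply/negP => /mapP[].
    move=> x d a; rewrite mem_rcons inE filter_rcons => /orP[/eqP->|/mapP[b _ ->]].
      by apply: (@hoare_le _ _ _ _ 1) => //; apply: hoare_skip.
    rewrite rev_rcons; exact: (push_at _ (fun t _ => F x [::] t [::])).
  by rewrite size_rcons ltnS.
apply: hoare_do_cons; last exact: hoare_do_nil.
have := @hoare_while _ _ rT (fun a => Do
        [:: PopLoop i predT (fun _ => Do [:: Pushr rW tick; Pushr rW tick]);
            PopLoop rW predT (fun _ => Pushr i tick);
            if a == digit true then Pushr i tick else Skip _ _])
   (fun t d => F l [::] t (nseq (digits_value d) tick)) (rev ds)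
   (L * 6 + 1 + (2 * L * 3 + 1 + (2 + 1))).
rewrite digits_value_bits => H; apply: hoare_le (H _ _) => //.
- by rewrite size_rev leq_add2r leq_mul2r szd orbT.
- by move=> t d; apply: sT.
move=> d a t E; set v := digits_value d.
have lev : v <= L.
  apply: leq_trans le; rewrite -[n]digits_value_bits -/ds E.
  by rewrite /digits_value foldl_cat; apply: foldl_value_ge.
apply: (@hoare_le _ _ _ _ (v * 6 + 1 + (2 * v * 3 + 1 + (2 + 1)))); first by lia.
apply: (hoare_do_cons (s2 := F l (nseq (2 * v) tick) t [::])).
  have := @hoare_while _ _ i (fun _ => Do [:: Pushr rW tick; Pushr rW tick])
    (fun r d => F l (nseq (2 * size d) tick) t r) (nseq v tick) (2 + (2 + 1)).
  rewrite size_nseq; apply; first by move=> ? ?; apply: si.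
  move=> d1 b r _; rewrite size_rcons mulnS.
  apply: hoare_do_cons; first exact: (push_at _ (fun w _ => F l w t r)).
  apply: hoare_do_cons; last exact: hoare_do_nil.
  exact: (push_at _ (fun w _ => F l w t r)).
apply: (hoare_do_cons (s2 := F l [::] t (nseq (2 * v) tick))).
  have := @hoare_while _ _ rW (fun _ => Pushr i tick)
    (fun w d => F l w t (nseq (size d) tick)) (nseq (2 * v) tick) 2.
  rewrite size_nseq; apply; first by move=> ? ?; apply: sW.
  move=> d1 b w _; rewrite size_rcons.
  exact: (push_at _ (fun r _ => F l w t r)).
apply: hoare_do_cons; last exact: hoare_do_nil.
rewrite /digits_value foldl_rcons -/(digits_value d) -/v -mul2n.
case: eqP => _; last first.
  by rewrite addn0; apply: (@hoare_le _ _ _ _ 1) => //; apply: hoare_skip.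
rewrite addn1; exact: (push_at _ (fun r _ => F l [::] t r)).
Qed.

Definition signed (b : bool) (z : int) : int := (if b then - z else z)%R.

Lemma enc_intP z : exists2 w, enc_int z = rcons w stop & stop \notin w.
Proof.
case: z => n; [exists (map digit (bits n)) | exists (minus :: map digit (bits n.+1))] => //.
  by apply/negP => /mapP[].
by rewrite inE /=; apply/negP => /mapP[].
Qed.

Definition skip_word : program := PopLoop rX (predC1 stop) (Pushr rY).

Definition copy_word : program :=
  PopLoop rX (predC1 stop) (fun a => Do [:: Pushr rY a; Pushr rO a]).

(* The opposite of an encoded integer is obtained by looking at its first
   symbol: a minus sign is dropped, zero (a mere stop) is kept. *)
Definition copy_opp_word : program :=
  PopLoop rX pred0 (fun a => Do [:: Pushr rY a;
    if a == minus then copy_word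
    else if a == stop then emit [:: stop]
    else Do [:: emit [:: minus; a]; copy_word]]).

Definition copy (b : bool) : program := if b then copy_opp_word else copy_word.

Definition skipT (L : nat) : nat := L * 3.
Definition copyT (L : nat) : nat := 6 * L + 20.

Lemma hoare_skip_word z L x u w m p y t b e : size (enc_int z) <= L ->
  hoare (St (enc_int z ++ x) u w m p y t b e) skip_word (skipT L)
        (St x u w m p (rev (enc_int z) ++ y) t b e).
Proof.
move=> le; have [s E ns] := enc_intP z.
have := @hoare_until _ _ rX stop (Pushr rY)
  (fun x d => St x u w m p (rev d ++ y) t b e) s x 2.
rewrite -E => H; apply: hoare_le (H _ _ _) => //; first by rewrite leq_mul2r le orbT.
by move=> l d a _; rewrite rev_rcons; apply: hoare_push.
Qed.

Lemma hoare_copy_word s L x u w m p y t b e :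
  stop \notin s -> size (rcons s stop) <= L ->
  hoare (St (rcons s stop ++ x) u w m p y t b e) copy_word (L * 6)
        (St x u w m p (rev (rcons s stop) ++ y) t b (e ++ rcons s stop)).
Proof.
move=> ns le.
have := @hoare_until _ _ rX stop (fun a => Do [:: Pushr rY a; Pushr rO a])
  (fun x d => St x u w m p (rev d ++ y) t b (e ++ d)) s x (2 + (2 + 1)).
rewrite cats0 => H; apply: hoare_le (H _ _ _) => //; first by rewrite leq_mul2r le orbT.
move=> l d a _; rewrite rev_rcons -rcons_cat.
apply: hoare_do_cons; first exact: hoare_push.
apply: hoare_do_cons; last exact: hoare_do_nil.
by rewrite /St rev_rcons; apply: hoare_push.
Qed.

Lemma hoare_copy c z L x u w m p y t b e : size (enc_int z) <= L ->
  hoare (St (enc_int z ++ x) u w m p y t b e) (copy c) (copyT L)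
        (St x u w m p (rev (enc_int z) ++ y) t b (e ++ enc_int (signed c z))).
Proof.
case: c => [le|]; last first.
  have [s E ns] := enc_intP z; rewrite /signed /= E => le.
  by apply: hoare_le (hoare_copy_word ns le); rewrite /copyT; lia.
have nd s : stop \notin map digit s by apply/negP => /mapP[].
(* Zero, positive and negative integers share the initial pop and the push on [rY]; only the
   treatment of the rest differs. *)
have first_symbol a s e' p' k : enc_int z = a :: s ->
    hoare (St (s ++ x) u w m p (a :: y) t b e)
      (if a == minus then copy_word else if a == stop then emit [:: stop]
       else Do [:: emit [:: minus; a]; copy_word]) k
      (St x u w m p (rev s ++ a :: y) t b e') -> k <= 6 * L + 16 -> e' = p' ->
    hoare (St (enc_int z ++ x) u w m p y t b e) (copy true) (copyT L)
      (St x u w m p (rev (enc_int z) ++ y) t b p').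
  move=> E H lek <-; rewrite E rev_cons cat_rcons.
  apply: (@hoare_le _ _ _ _ (2 + (k + 1)).+1); first by rewrite /copyT; lia.
  apply: (hoare_loop_stop (a := a)) => //.
  apply: hoare_do_cons; first exact: hoare_push.
  by apply: hoare_do_cons; [exact: H | exact: hoare_do_nil].
case: z le first_symbol => [[|n]|n] le first_symbol.
- apply: (first_symbol stop [::] (e ++ [:: stop]) _ (emitT [:: stop])).
  + by rewrite /= /enc_nat bits_rec.
  + exact: hoare_emit.
  + by rewrite /emitT /=; lia.
  + by rewrite /signed oppr0 /= /enc_nat bits_rec.
- have Eb : bits n.+1 = head false (bits n.+1) :: behead (bits n.+1).
    by rewrite bits_rec.
  apply: (first_symbol (digit (head false (bits n.+1)))
      (rcons (map digit (behead (bits n.+1))) stop)).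
  + by rewrite /= /enc_nat {1}Eb.
  + apply: hoare_do_cons; first exact: hoare_emit.
    apply: hoare_do_cons; last exact: hoare_do_nil.
    apply: (hoare_copy_word (L := L)) => //.
    by move: le; rewrite /= /enc_nat {1}Eb /= => /ltnW.
  + by rewrite /emitT /=; lia.
  by rewrite -catA /= /enc_nat {3}Eb.
- apply: (first_symbol minus (enc_nat n.+1) (e ++ enc_nat n.+1) _ (L * 6)) => //.
  + by apply: hoare_copy_word => //; apply: ltnW le.
  + by lia.
Qed.

(** * Reading the columns of a matrix that is stored by rows *)

Section Columns.
Variables (ws : seq (seq symbol)) (g : seq symbol) (m n L : nat) (E : nat -> nat -> int).
Hypothesis size_ws : size ws = m.+2 * n.
Hypothesis nth_ws : forall i j, i < m.+2 -> j < n -> nth [::] ws (i * n + j) = enc_int (E i j).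
Hypotheses (wsL : size (flatten ws) <= L) (mL : m <= L) (nL : n <= L).

Definition unread q := flatten (drop q ws) ++ g.
Definition already_read q := rev (flatten (take q ws)).

Lemma read_word i j : i < m.+2 -> j < n ->
  [/\ size (enc_int (E i j)) <= L,
      unread (i * n + j) = enc_int (E i j) ++ unread (i * n + j).+1 &
      already_read (i * n + j).+1 = rev (enc_int (E i j)) ++ already_read (i * n + j)].
Proof.
move=> lti ltj.
have lt : i * n + j < size ws by rewrite size_ws; nia.
split.
- apply: leq_trans wsL; rewrite -(cat_take_drop (i * n + j) ws) (drop_nth [::] lt).
  by rewrite nth_ws // flatten_cat /= !size_cat; lia.
- by rewrite /unread (drop_nth [::] lt) nth_ws //= catA.
by rewrite /already_read (take_nth [::] lt) nth_ws // flatten_rcons rev_cat.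
Qed.

(** Inside [rows], [rW] and [rU] hold [j] and [n - j.+1] in unary, so exactly the entry in column
    [j] of the current row is copied. *)
Definition pick (c : bool) : program :=
  Do [:: For rW rT skip_word; copy c; For rU rT skip_word].

Definition pickT : nat :=
  forT L (skipT L) + (copyT L + (forT L (skipT L) + 1)).

Lemma hoare_pick c i j p r b e : i < m.+2 -> j < n ->
  hoare (St (unread (i * n)) (nseq (n - j.+1) tick) (nseq j tick) r p (already_read (i * n)) [::] b e)
    (pick c) pickT
    (St (unread (i.+1 * n)) (nseq (n - j.+1) tick) (nseq j tick) r p (already_read (i.+1 * n)) [::] b
       (e ++ enc_int (signed c (E i j)))).
Proof.
move=> lti ltj.
apply: (hoare_do_cons (s2 := St (unread (i * n + j)) (nseq (n - j.+1) tick)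
    (nseq j tick) r p (already_read (i * n + j)) [::] b e)).
  have := @hoare_for _ _ rW rT skip_word
    (fun q w t => St (unread (i * n + q)) (nseq (n - j.+1) tick) w r p
       (already_read (i * n + q)) t b e) j tick (skipT L) L.
  rewrite addn0; apply=> //; first by lia.
  move=> q lt; have [sz -> Ed] := read_word lti (ltn_trans lt ltj).
  by rewrite addnS Ed; apply: hoare_skip_word.
apply: (hoare_do_cons (s2 := St (unread (i * n + j.+1)) (nseq (n - j.+1) tick)
    (nseq j tick) r p (already_read (i * n + j.+1)) [::] b (e ++ enc_int (signed c (E i j))))).
  have [sz -> Ed] := read_word lti ltj.
  rewrite addnS Ed.
  exact: hoare_copy.
apply: hoare_do_cons; last exact: hoare_do_nil.
have := @hoare_for _ _ rU rT skip_word
    (fun q u t => St (unread (i * n + j.+1 + q)) u (nseq j tick) r p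
       (already_read (i * n + j.+1 + q)) t b (e ++ enc_int (signed c (E i j)))) (n - j.+1) tick (skipT L) L.
rewrite addn0 mulSnr -addnA subnKC //; apply=> //; first by lia.
move=> q lt; have lt' : j.+1 + q < n by lia.
have [sz Eu Ed] := read_word lti lt'.
by rewrite [_ + q.+1]addnS -[i * n + j.+1 + q]addnA Eu Ed; apply: hoare_skip_word.
Qed.

(** The two extra picks read the source and the target; the last loop rewinds the input for the next
    column. *)
Definition column (c : bool) : program :=
  Do [:: For rM rP (pick c); pick c; pick c; PopLoop rY predT (Pushr rX)].

Definition columnT : nat := forT L pickT + (pickT + (pickT + (L * 3 + 1 + 1))).

Definition column_text c j := flatten (mkseq (fun i => enc_int (signed c (E i j))) m.+2).

Lemma hoare_column c j b e : j < n ->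
  hoare (St (flatten ws ++ g) (nseq (n - j.+1) tick) (nseq j tick) (nseq m tick) [::] [::] [::] b e)
    (column c) columnT
    (St (flatten ws ++ g) (nseq (n - j.+1) tick) (nseq j tick) (nseq m tick) [::] [::] [::] b
       (e ++ column_text c j)).
Proof.
move=> ltj.
pose tx q := flatten (mkseq (fun i => enc_int (signed c (E i j))) q).
have txS q : tx q.+1 = tx q ++ enc_int (signed c (E q j)).
  by rewrite /tx /mkseq -addn1 iotaD map_cat flatten_cat /= cats0.
rewrite /column_text -/(tx m.+2).
apply: (hoare_do_cons (s2 := St (unread (m * n)) (nseq (n - j.+1) tick) (nseq j tick)
   (nseq m tick) [::] (already_read (m * n)) [::] b (e ++ tx m))).
  have := @hoare_for _ _ rM rP (pick c)
    (fun q r p => St (unread (q * n)) (nseq (n - j.+1) tick) (nseq j tick)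
       r p (already_read (q * n)) [::] b (e ++ tx q)) m tick pickT L.
  rewrite mul0n /unread /already_read drop0 take0 cats0; apply=> // q lt.
  by rewrite txS catA; apply: hoare_pick => //; lia.
apply: hoare_do_cons; first by apply: hoare_pick.
apply: hoare_do_cons; first by apply: hoare_pick.
rewrite -(catA e) -txS -(catA e) -txS.
apply: hoare_do_cons; last exact: hoare_do_nil.
have := @hoare_while _ _ rY (Pushr rX)
  (fun y d => St (rev d ++ g) (nseq (n - j.+1) tick) (nseq j tick)
       (nseq m tick) [::] y [::] b (e ++ tx m.+2)) (rev (flatten ws)) 2.
rewrite revK /unread /already_read -size_ws drop_size take_size size_rev.
move=> H; apply: hoare_le (H _ _) => //; first by rewrite leq_add2r leq_mul2r wsL orbT.
by move=> d a y _; rewrite rev_rcons; apply: hoare_push.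
Qed.

Definition rows (c : bool) (s1 s2 s3 : seq symbol) : program :=
  For rU rW (Do [:: column c; emit s1; Emits rM rT s2; emit s3]).

Definition rowsT s1 s2 s3 : nat :=
  forT L (columnT + (emitT s1 + (forT L (emitT s2) + (emitT s3 + 1)))).

Lemma hoare_rows c s1 s2 s3 b e :
  hoare (St (flatten ws ++ g) (nseq n tick) [::] (nseq m tick) [::] [::] [::] b e)
    (rows c s1 s2 s3) (rowsT s1 s2 s3)
    (St (flatten ws ++ g) (nseq n tick) [::] (nseq m tick) [::] [::] [::] b
       (e ++ flatten (mkseq (fun j => column_text c j ++ s1 ++ flatten (nseq m s2) ++ s3) n))).
Proof.
pose tx q := flatten (mkseq (fun j => column_text c j ++ s1 ++ flatten (nseq m s2) ++ s3) q).
have := @hoare_for _ _ rU rW (Do [:: column c; emit s1; Emits rM rT s2; emit s3])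
  (fun q u w => St (flatten ws ++ g) u w (nseq m tick) [::] [::] [::] b (e ++ tx q)) n tick _ L.
rewrite cats0; apply=> // q lt.
have -> : tx q.+1 = tx q ++ column_text c q ++ s1 ++ flatten (nseq m s2) ++ s3.
  by rewrite /tx /mkseq -addn1 iotaD map_cat flatten_cat /= cats0.
apply: hoare_do_cons; first exact: hoare_column.
apply: hoare_do_cons; first exact: hoare_emit.
apply: hoare_do_cons; first exact: hoare_emits_M.
rewrite -!catA; apply: hoare_do_cons; last exact: hoare_do_nil.
rewrite !catA; exact: hoare_emit.
Qed.

End Columns.

(** * Writing the text of the loop *)

Definition zero := [:: stop].
Definition one := [:: digit true; stop].
Definition opp_one := minus :: one.
Definition zeros q := flatten (nseq q zero).

Definition unit_text (m q : nat) (c : seq symbol) :=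
  zeros q ++ c ++ zeros (m - q.+1) ++ zeros 3.

(** Run inside a loop over [rM] and [rP], whose contents give the numbers of zeros on the two sides
    of the entry [c]. The last three zeros belong to [s], [t] and [k]. *)
Definition unit_row (c : seq symbol) : program :=
  Do [:: Emits rP rT zero; emit c; Emits rM rT zero; emit (zeros 3)].

Definition unit_rowT L c : nat :=
  forT L (emitT zero) + (emitT c + (forT L (emitT zero) + (emitT (zeros 3) + 1))).

Lemma hoare_unit_row c q m L x u v y b e : q < m -> m <= L ->
  hoare (St x u v (nseq (m - q.+1) tick) (nseq q tick) y [::] b e)
    (unit_row c) (unit_rowT L c)
    (St x u v (nseq (m - q.+1) tick) (nseq q tick) y [::] b (e ++ unit_text m q c)).
Proof.
move=> lt le; rewrite /unit_text 3!catA.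
apply: hoare_do_cons; first by apply: hoare_emits_P; lia.
apply: hoare_do_cons; first exact: hoare_emit.
apply: hoare_do_cons; first by apply: hoare_emits_M; lia.
by apply: hoare_do_cons; [exact: hoare_emit | exact: hoare_do_nil].
Qed.

Definition unit_rows (cs : seq (seq symbol)) : program :=
  For rM rP (Do (map unit_row cs)).

Definition unit_rowsT L cs : nat := forT L (foldr (fun c t => unit_rowT L c + t) 1 cs).

Lemma hoare_unit_rows cs m L x u v y b e : m <= L ->
  hoare (St x u v (nseq m tick) [::] y [::] b e) (unit_rows cs) (unit_rowsT L cs)
    (St x u v (nseq m tick) [::] y [::] b
       (e ++ flatten (mkseq (fun q => flatten (map (unit_text m q) cs)) m))).
Proof.
move=> le; pose tx q := flatten (mkseq (fun q => flatten (map (unit_text m q) cs)) q).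
have := @hoare_for _ _ rM rP (Do (map unit_row cs))
  (fun q r p => St x u v r p y [::] b (e ++ tx q)) m tick _ L.
rewrite cats0; apply=> // q lt.
have -> : tx q.+1 = tx q ++ flatten (map (unit_text m q) cs).
  by rewrite /tx /mkseq -addn1 iotaD map_cat flatten_cat /= cats0.
rewrite catA; move: (e ++ tx q); clear tx.
elim: cs => [|c cs IH] e'; first by rewrite cats0; apply: hoare_do_nil.
rewrite /= catA; apply: hoare_do_cons; last exact: IH.
exact: hoare_unit_row.
Qed.

Definition fixed_text (m : nat) (r : seq symbol * seq symbol * seq symbol * seq symbol) :=
  let: (a, s1, b, s2) := r in
  flatten (nseq m a) ++ s1 ++ flatten (nseq m b) ++ s2.

Definition fixed_row (r : seq symbol * seq symbol * seq symbol * seq symbol) : program :=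
  let: (a, s1, b, s2) := r in
  Do [:: Emits rM rT a; emit s1; Emits rM rT b; emit s2].

Definition fixed_rowT L (r : seq symbol * seq symbol * seq symbol * seq symbol) : nat :=
  let: (a, s1, b, s2) := r in
  forT L (emitT a) + (emitT s1 + (forT L (emitT b) + (emitT s2 + 1))).

Lemma hoare_fixed_rows rs m L x u v p y b e : m <= L ->
  hoare (St x u v (nseq m tick) p y [::] b e) (Do (map fixed_row rs))
    (foldr (fun r t => fixed_rowT L r + t) 1 rs)
    (St x u v (nseq m tick) p y [::] b (e ++ flatten (map (fixed_text m) rs))).
Proof.
move=> le; elim: rs e => [|[[[a s1] c] s2] rs IH] e.
  by rewrite cats0; apply: hoare_do_nil.
rewrite [flatten _]/(fixed_text m (a, s1, c, s2) ++ flatten (map _ rs)) (catA e).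
apply: hoare_do_cons; last exact: IH.
rewrite /fixed_text 3!catA.
apply: hoare_do_cons; first exact: hoare_emits_M.
apply: hoare_do_cons; first exact: hoare_emit.
apply: hoare_do_cons; first exact: hoare_emits_M.
by apply: hoare_do_cons; [exact: hoare_emit | exact: hoare_do_nil].
Qed.

Definition count (i j : 'I_10) : program := For i j inc.

Lemma hoare_count_M m c L x u v y e : m <= L -> c + m <= L ->
  hoare (St x u v (nseq m tick) [::] y [::] (map digit (bits c)) e)
    (count rM rP) (forT L (incT L))
    (St x u v (nseq m tick) [::] y [::] (map digit (bits (c + m))) e).
Proof.
move=> le leL.
have := @hoare_for _ _ rM rP inc
  (fun q r p => St x u v r p y [::] (map digit (bits (c + q))) e) m tick (incT L) L.
rewrite addn0; apply=> // q lt; rewrite addnS.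
by apply: hoare_inc; lia.
Qed.

Lemma hoare_count_U n c L x m p y e : n <= L -> c + n <= L ->
  hoare (St x (nseq n tick) [::] m p y [::] (map digit (bits c)) e)
    (count rU rW) (forT L (incT L))
    (St x (nseq n tick) [::] m p y [::] (map digit (bits (c + n))) e).
Proof.
move=> le leL.
have := @hoare_for _ _ rU rW inc
  (fun q r p => St x r p m [::] y [::] (map digit (bits (c + q))) e) n tick (incT L) L.
rewrite addn0 => H.
have := @hoare_for _ _ rU rW inc
  (fun q r w => St x r w m p y [::] (map digit (bits (c + q))) e) n tick (incT L) L.
rewrite addn0; apply=> // q lt; rewrite addnS.
by apply: hoare_inc; lia.
Qed.

Lemma hoare_incs k c L x u v m p y e : c + k <= L ->
  hoare (St x u v m p y [::] (map digit (bits c)) e)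
    (Do (nseq k inc)) (k * incT L + 1)
    (St x u v m p y [::] (map digit (bits (c + k))) e).
Proof.
elim: k c => [|k IH] c le; first by rewrite addn0; apply: hoare_do_nil.
rewrite mulSn -addnA; apply: hoare_do_cons; first by apply: hoare_inc; lia.
by rewrite -(addSnnS c); apply: IH; lia.
Qed.

(* The rows of the update matrix that do not depend on the displacements, cut
   at the blocks of [m] equal entries. *)
Definition fixed_blocks : seq (seq symbol * seq symbol * seq symbol * seq symbol) :=
  [:: (opp_one, zeros 3, one, zeros 3);
      (zero, one ++ zero ++ zero, zero, zeros 3);
      (zero, opp_one ++ zero ++ zero, zero, zeros 3);
      (zero, zero ++ one ++ zero, zero, zeros 3);
      (zero, zero ++ opp_one ++ zero, zero, zeros 3);
      (zero, zero ++ one ++ opp_one, zero, zero ++ zero ++ one);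
      (zero, zero ++ zero ++ opp_one, zero, zeros 3)].

Definition bounds_text := one ++ one ++ opp_one ++ zero ++ one ++ opp_one ++ zero.

Definition write_loop : program := Do
  [:: count rM rP; Do (nseq 3 inc); emit_counter;
      count rM rP; count rM rP; emit_counter;
      unit_rows [:: one]; unit_rows [:: opp_one];
      Emits rM rT zero; Emits rM rT zero; emit zero;
      count rU rW; count rU rW; count rM rP; Do (nseq 7 inc); emit_counter;
      rows true zero zero (zeros 3); rows false opp_one zero (zero ++ zero ++ one);
      unit_rows [:: one; opp_one]; Do (map fixed_row fixed_blocks);
      Emits rU rT zero; Emits rU rT zero; Emits rM rT zero; emit bounds_text].

(** The [zero] before the number of update rows is the number of guard rows: the guard is empty, and
    all tests on the current state sit in the update matrix. *)
Definition loop_text (m n : nat) (E : nat -> nat -> int) : seq symbol :=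
  enc_nat (m + 3) ++ enc_nat (m + m) ++
  flatten (mkseq (fun q => flatten (map (unit_text m q) [:: one])) m) ++
  flatten (mkseq (fun q => flatten (map (unit_text m q) [:: opp_one])) m) ++
  zeros m ++ zeros m ++ zero ++
  enc_nat (n + n + m + 7) ++
  flatten (mkseq (fun j => column_text m E true j ++ zero ++ zeros m ++ zeros 3) n) ++
  flatten (mkseq (fun j => column_text m E false j ++ opp_one ++ zeros m ++
                           (zero ++ zero ++ one)) n) ++
  flatten (mkseq (fun q => flatten (map (unit_text m q) [:: one; opp_one])) m) ++
  flatten (map (fixed_text m) fixed_blocks) ++
  zeros n ++ zeros n ++ zeros m ++ bounds_text.

Definition write_loopT L : nat :=
  forT L (incT L) + ((3 * incT L + 1) + (emit_counterT L +
  (forT L (incT L) + (forT L (incT L) + (emit_counterT L +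
  (unit_rowsT L [:: one] + (unit_rowsT L [:: opp_one] +
  (forT L (emitT zero) + (forT L (emitT zero) + (emitT zero +
  (forT L (incT L) + (forT L (incT L) + (forT L (incT L) + ((7 * incT L + 1) +
  (emit_counterT L +
  (rowsT L zero zero (zeros 3) + (rowsT L opp_one zero (zero ++ zero ++ one) +
  (unit_rowsT L [:: one; opp_one] +
  (foldr (fun r t => fixed_rowT L r + t) 1 fixed_blocks +
  (forT L (emitT zero) + (forT L (emitT zero) + (forT L (emitT zero) +
  (emitT bounds_text + 1))))))))))))))))))))))).

Lemma hoare_write_loop ws g m n L E :
  size ws = m.+2 * n ->
  (forall i j, i < m.+2 -> j < n -> nth [::] ws (i * n + j) = enc_int (E i j)) ->
  size (flatten ws) <= L -> n + n + m + m + 7 <= L ->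
  hoare (St (flatten ws ++ g) (nseq n tick) [::] (nseq m tick) [::] [::] [::] [::] [::])
    write_loop (write_loopT L)
    (St (flatten ws ++ g) (nseq n tick) [::] (nseq m tick) [::] [::] [::] [::]
       (loop_text m n E)).
Proof.
move=> szws nthws wsL le.
have [mL nL] : m <= L /\ n <= L by split; lia.
(* The empty stack is the numeral 0. Since [emit_counter] empties [rB], every count restarts from
   there. *)
have b0 : [::] = map digit (bits 0) by rewrite bits_rec.
rewrite -[loop_text _ _ _]cat0s /loop_text 15!catA.
apply: hoare_do_cons.
  by rewrite {5}b0; apply: (hoare_count_M (c := 0)); lia.
apply: hoare_do_cons; first by apply: hoare_incs; lia.
apply: hoare_do_cons; first by apply: hoare_emit_counter; lia.
apply: hoare_do_cons.
  by rewrite {5}b0; apply: (hoare_count_M (c := 0)); lia.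
apply: hoare_do_cons; first by apply: hoare_count_M; lia.
apply: hoare_do_cons; first by apply: hoare_emit_counter; lia.
apply: hoare_do_cons; first exact: hoare_unit_rows.
apply: hoare_do_cons; first exact: hoare_unit_rows.
apply: hoare_do_cons; first exact: hoare_emits_M.
apply: hoare_do_cons; first exact: hoare_emits_M.
apply: hoare_do_cons; first exact: hoare_emit.
apply: hoare_do_cons.
  by rewrite {5}b0; apply: (hoare_count_U (c := 0)); lia.
apply: hoare_do_cons; first by apply: hoare_count_U; lia.
apply: hoare_do_cons; first by apply: hoare_count_M; lia.
apply: hoare_do_cons; first by apply: hoare_incs; lia.
apply: hoare_do_cons; first by apply: hoare_emit_counter; lia.
apply: hoare_do_cons; first exact: (hoare_rows szws nthws).
apply: hoare_do_cons; first exact: (hoare_rows szws nthws).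
apply: hoare_do_cons; first exact: hoare_unit_rows.
apply: hoare_do_cons; first exact: hoare_fixed_rows.
apply: hoare_do_cons; first exact: hoare_emits_U.
apply: hoare_do_cons; first exact: hoare_emits_U.
apply: hoare_do_cons; first exact: hoare_emits_M.
by apply: hoare_do_cons; [exact: hoare_emit | exact: hoare_do_nil].
Qed.

(** With [pred0] the loop is a conditional: [m] is read only when the dimension is positive, and
    otherwise its unary copy stays empty. The final loop reverses the output. *)
Definition reduction : program := Do
  [:: read_unary rU; PopLoop rU pred0 (fun a => Do [:: Pushr rU a; read_unary rM]);
      write_loop; PopLoop rO predT (Pushr rR)].

Definition reductionT L : nat :=
  read_unaryT L + ((2 + (read_unaryT L + 1)).+1 +
  (write_loopT L + ((write_loopT L + 1) * 3 + 1 + 1))).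

Lemma hoare_reduction (m n L : nat) ws E (m' := if n is 0 then 0 else m) :
  size ws = m'.+2 * n ->
  (forall i j, i < m'.+2 -> j < n -> nth [::] ws (i * n + j) = enc_int (E i j)) ->
  size (flatten ws) <= L -> n + n + m' + m' + 7 <= L ->
  exists2 s, hoare [:: enc_nat n ++ enc_nat m ++ flatten ws] reduction (reductionT L) s &
    nth [::] s 9 = loop_text m' n E.
Proof.
move=> szws nthws wsL le.
(* In dimension 0 the numeral of [m] remains unread on [rX]. *)
pose g := if n is 0 then enc_nat m else [::].
pose S x u m e := St x u [::] m [::] [::] [::] [::] e.
have start s x t : hoare (S x [::] [::] [::]) reduction t s -> hoare [:: x] reduction t s.
  move=> H T hT; apply: H => i; have := hT i.
  rewrite (_ : nth [::] [:: x] i = nth [::] (x :: nseq 9 [::]) i) //.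
  by case: i => [[|i] lti]; rewrite // -!nth_behead nth_nil nth_nseq if_same.
have writing := @hoare_write_loop ws g m' n L E szws nthws wsL le.
exists [:: flatten ws ++ g; nseq n tick; [::]; nseq m' tick; [::]; [::]; [::]; [::]; [::];
           loop_text m' n E] => //.
apply: start.
apply: (hoare_do_cons (s2 := S (enc_nat m ++ flatten ws) (nseq n tick) [::] [::])).
  by apply: (@hoare_read_unary rU (fun x w t u => St x u w [::] [::] [::] t [::] [::])) => //; lia.
apply: (hoare_do_cons (s2 := S (flatten ws ++ g) (nseq n tick) (nseq m' tick) [::])).
  rewrite /g; clear g writing nthws; subst m'; case: n szws le => [|k] szws le.
    rewrite muln0 in szws; rewrite (size0nil szws) cats0.
    by apply: (@hoare_le _ _ _ _ 1) => //; apply: hoare_loop_nil.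
  rewrite cats0; apply: (hoare_loop_stop (a := tick)) => //.
  apply: hoare_do_cons; first exact: hoare_push.
  apply: hoare_do_cons; last exact: hoare_do_nil.
  by apply: (@hoare_read_unary rM
    (fun x w t r => St x (nseq k.+1 tick) w r [::] [::] t [::] [::])) => //; lia.
apply: hoare_do_cons; first exact: writing.
apply: hoare_do_cons; last exact: hoare_do_nil.
have := @hoare_while _ _ rO (Pushr rR) (fun o d =>
  [:: flatten ws ++ g; nseq n tick; [::]; nseq m' tick; [::]; [::]; [::]; [::]; o; rev d])
  (rev (loop_text m' n E)) 2.
rewrite revK => H; apply: hoare_le (H _ _) => //.
  (* The text is no longer than the time spent writing it, up to one cell. *)
  have := hoare_size rO writing.
  by rewrite /= add0n leq_add2r leq_mul2r => ->; rewrite orbT.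
by move=> d a l _; rewrite rev_rcons; apply: hoare_push.
Qed.

Ltac poly_tac := repeat first
  [ exact: poly_const | exact: poly_id | exact: poly_succ | apply: polyD | apply: polyM
  | match goal with |- poly_bounded (fun N => (@?P N).+1) =>
      apply: (polyD (P := fun _ => 1)) end ].

Lemma poly_reductionT : poly_bounded reductionT.
Proof.
rewrite /reductionT /write_loopT /rowsT /columnT /pickT /skipT /copyT.
rewrite /unit_rowsT /unit_rowT /= /fixed_rowT /= /emit_counterT /read_unaryT.
rewrite /forT /incT /emitT /=.
by poly_tac.
Qed.

(** * The loop attached to a vector addition system *)

Local Open Scope ring_scope.

Definition mx_of_rows p q (rs : seq (seq int)) : 'M[int]_(p, q) :=
  \matrix_(i, j) nth 0 (nth [::] rs i) j.

Definition eints (s : seq int) : seq symbol := flatten (map enc_int s).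

Lemma eints_cat s1 s2 : eints (s1 ++ s2) = eints s1 ++ eints s2.
Proof. by rewrite /eints map_cat flatten_cat. Qed.

Lemma eints_cons z s : eints (z :: s) = enc_int z ++ eints s.
Proof. by []. Qed.

Lemma eints_nseq q z : eints (nseq q z) = flatten (nseq q (enc_int z)).
Proof. by rewrite /eints map_nseq. Qed.

Lemma eints_flatten ss : eints (flatten ss) = flatten (map eints ss).
Proof. by elim: ss => //= s ss IH; rewrite eints_cat IH. Qed.

Lemma enc_mx_of_rows p q rs : size rs = p -> all (fun r => size r == q) rs ->
  enc_mx (mx_of_rows p q rs) = eints (flatten rs).
Proof.
move=> szrs /allP szr; rewrite /eints map_flatten /enc_mx; congr (flatten (flatten _)).
rewrite -[in RHS](mkseq_nth [::] rs) szrs /mkseq -val_enum_ord -!map_comp.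
apply: eq_map => i /=; have /eqP szi : size (nth [::] rs i) == q.
  by apply: szr; rewrite mem_nth // szrs.
rewrite -[in RHS](mkseq_nth 0 (nth [::] rs i)) szi /mkseq -val_enum_ord -!map_comp.
by apply: eq_map => j /=; rewrite mxE.
Qed.

Lemma enc_int0 : enc_int 0 = zero.
Proof. by rewrite -[0]/(Posz 0) /= /enc_nat bits_rec. Qed.
Lemma enc_int1 : enc_int 1 = one.
Proof. by rewrite -[1]/(Posz 1) /= /enc_nat bits_rec. Qed.
Lemma enc_intN1 : enc_int (-1) = opp_one.
Proof. by rewrite -[-1]/(Negz 0) /= /enc_nat bits_rec. Qed.

Section TheLoop.
Variables (m n : nat) (E : nat -> nat -> int).

Definition unit_seq (c : int) (q : nat) : seq int := nseq q 0 ++ c :: nseq (m - q.+1) 0.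

Definition pre_rows : seq (seq int) :=
  mkseq (fun q => unit_seq 1 q ++ [:: 0; 0; 0]) m ++
  mkseq (fun q => unit_seq (-1) q ++ [:: 0; 0; 0]) m.

Definition row6 (A : seq int) (a b c : int) (B : seq int) (a' b' c' : int) : seq int :=
  A ++ [:: a; b; c] ++ B ++ [:: a'; b'; c'].

(** Used with bound 0 in two ways: negated, without the counter, it says [x_j >= 0]; unnegated, with
    coefficients -1 and 1 for [k] and [k'], it says [x_j <= k - k']. *)
Definition column_row (sg : bool) (c c' : int) (j : nat) : seq int :=
  row6 (mkseq (fun i => signed sg (E i j)) m) (signed sg (E m j)) (signed sg (E m.+1 j)) c
    (nseq m 0) 0 0 c'.

(** In order: at most one firing, [s = 1] (two rows), [-1 <= t <= 0] (two rows), [k - k' >= 1 + t],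
    and [k >= 0]. *)
Definition fixed_constraints : seq (seq int * int) :=
  let: Z := nseq m 0 in
  [:: (row6 (nseq m (-1)) 0 0 0 (nseq m 1) 0 0 0, 1);
      (row6 Z 1 0 0 Z 0 0 0, 1);
      (row6 Z (-1) 0 0 Z 0 0 0, -1);
      (row6 Z 0 1 0 Z 0 0 0, 0);
      (row6 Z 0 (-1) 0 Z 0 0 0, 1);
      (row6 Z 0 1 (-1) Z 0 0 1, -1);
      (row6 Z 0 0 (-1) Z 0 0 0, 0)].

Definition constraints : seq (seq int * int) :=
  mkseq (fun j => (column_row true 0 0 j, 0)) n ++
  mkseq (fun j => (column_row false (-1) 1 j, 0)) n ++
  mkseq (fun q => (row6 (unit_seq 1 q) 0 0 0 (unit_seq (-1) q) 0 0 0, 0)) m ++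
  fixed_constraints.

(* The variables are the numbers [Y] of firings of each of the [m]
   displacements, the multiplicities [s] and [t] of the source and of the
   target, and a counter [k]. *)
Definition vas_loop : loop :=
  @Loop (m + 3)%N
    (m + m)%N (mx_of_rows _ _ pre_rows) (mx_of_rows _ 1 (nseq (m + m)%N [:: 0]))
    0 (mx_of_rows _ _ [::]) (mx_of_rows _ 1 [::])
    (n + n + m + 7)%N (mx_of_rows _ _ (map fst constraints))
    (mx_of_rows _ 1 (map (fun c => [:: c.2]) constraints)).

Lemma size_constraints : size constraints = (n + n + m + 7)%N.
Proof. by rewrite /constraints !size_cat !size_mkseq /= !addnA. Qed.

Lemma size_unit_seq c q : (q < m)%N -> size (unit_seq c q) = m.
Proof. by move=> lt; rewrite size_cat /= !size_nseq; lia. Qed.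

Lemma size_row6 A a b c B a' b' c' : size A = m -> size B = m ->
  size (row6 A a b c B a' b' c') = (m + 3 + (m + 3))%N.
Proof. by move=> EA EB; rewrite !size_cat /= EA EB; lia. Qed.

Lemma size_constraint r : r \in constraints -> size r.1 = (m + 3 + (m + 3))%N.
Proof.
rewrite !mem_cat => /or4P[/mapP[q _ ->]|/mapP[q _ ->]|/mapP[q]|].
- by apply: size_row6; rewrite ?size_mkseq ?size_nseq.
- by apply: size_row6; rewrite ?size_mkseq ?size_nseq.
- by rewrite mem_iota add0n => /= lt ->; apply: size_row6; rewrite size_unit_seq.
have /allP H : all (fun r => size r.1 == (m + 3 + (m + 3))%N) fixed_constraints.
  by rewrite /= !size_row6 ?size_nseq ?eqxx.
by move/H/eqP.
Qed.

Lemma enc_vas_loop : enc_loop vas_loop = loop_text m n E.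
Proof.
have sz_col p c : all (fun r => size r == 1%N) (nseq p [:: c : int]).
  by apply/allP => r; rewrite mem_nseq => /andP[_ /eqP->].
have szp : size pre_rows = (m + m)%N by rewrite size_cat !size_mkseq.
have allp : all (fun r => size r == (m + 3)%N) pre_rows.
  apply/allP => r; rewrite mem_cat => /orP[] /mapP[q]; rewrite mem_iota add0n => /= lt ->.
    by rewrite size_cat size_unit_seq.
  by rewrite size_cat size_unit_seq.
have allc : all (fun r => size r == (m + 3 + (m + 3))%N) (map fst constraints).
  by apply/allP => _ /mapP[r /size_constraint <- ->].
have allb : all (fun r => size r == 1%N) (map (fun c => [:: c.2]) constraints).
  by rewrite all_map; apply/allP.
rewrite /enc_loop /= !enc_mx_of_rows ?size_nseq ?size_map ?size_constraints //.
rewrite /loop_text.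
have e3 : eints [:: 0; 0; 0] = zeros 3 by rewrite -[[:: 0; 0; 0]]/(nseq 3 0) eints_nseq enc_int0.
have eunit c q : eints (unit_seq c q ++ [:: 0; 0; 0]) = unit_text m q (enc_int c).
  by rewrite eints_cat e3 /unit_seq eints_cat eints_cons !eints_nseq enc_int0 -!catA.
have emk (f : nat -> seq int) (g : nat -> seq symbol) p :
    (forall q, eints (f q) = g q) -> eints (flatten (mkseq f p)) = flatten (mkseq g p).
  by move=> fg; rewrite eints_flatten -map_comp; congr flatten; apply: eq_map.
have ecol sg c j : eints (mkseq (fun i => signed sg (E i j)) m ++
    [:: signed sg (E m j); signed sg (E m.+1 j); c]) = column_text m E sg j ++ enc_int c.
  rewrite /column_text /mkseq -addn2 iotaD map_cat flatten_cat /= cats0 add0n.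
  by rewrite eints_cat /eints /= !cats0 -!catA -map_comp.
have erow6 A a b c B a' b' c' : eints (row6 A a b c B a' b' c') =
    eints (A ++ [:: a; b; c]) ++ eints (B ++ [:: a'; b'; c']).
  by rewrite /row6 catA eints_cat.
have -> : eints (flatten pre_rows) =
    flatten (mkseq (fun q => flatten [seq unit_text m q i | i <- [:: one]]) m) ++
    flatten (mkseq (fun q => flatten [seq unit_text m q i | i <- [:: opp_one]]) m).
  rewrite flatten_cat eints_cat.
  by congr (_ ++ _); apply: emk => q; rewrite eunit /= ?enc_int1 ?enc_intN1 cats0.
have -> : eints (flatten (nseq (m + m)%N [:: 0])) = zeros m ++ zeros m.
  rewrite eints_flatten map_nseq nseqD flatten_cat.
  by rewrite (_ : eints [:: 0] = zero) // -enc_int0 /eints /= cats0.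
have -> : eints (flatten (map fst constraints)) =
  flatten (mkseq (fun j => column_text m E true j ++ zero ++ zeros m ++ zeros 3) n) ++
  flatten (mkseq (fun j => column_text m E false j ++ opp_one ++ zeros m ++ zero ++ zero ++ one) n) ++
  flatten (mkseq (fun q => flatten [seq unit_text m q i | i <- [:: one; opp_one]]) m) ++
  flatten [seq fixed_text m i | i <- fixed_blocks].
  rewrite !map_cat !flatten_cat !eints_cat /mkseq -!map_comp.
  congr (_ ++ _); [|congr (_ ++ _); [|congr (_ ++ _)]].
  - apply: emk => j /=; rewrite erow6 ecol enc_int0 eints_cat eints_nseq enc_int0 e3.
    by rewrite -catA.
  - apply: emk => j /=; rewrite erow6 ecol enc_intN1 eints_cat eints_nseq enc_int0.
    by rewrite !eints_cons enc_int0 enc_int1 cats0 -catA.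
  - apply: emk => q /=; rewrite erow6 !eunit enc_int1 enc_intN1.
    by rewrite cats0.
  rewrite !eints_nseq !eints_cons enc_int0 enc_int1 enc_intN1.
  by rewrite /fixed_blocks /= !cats0 -!catA.
have -> : eints (flatten [seq [:: c.2] | c <- constraints]) =
    zeros n ++ zeros n ++ zeros m ++ bounds_text.
  rewrite (_ : flatten _ = map snd constraints); last by elim: constraints => //= c s ->.
  rewrite !map_cat !eints_cat /mkseq -!map_comp.
  have ez p : eints [seq (0 : int) | _ <- iota 0 p] = zeros p.
    rewrite -[p in RHS](size_iota 0 p); elim: (iota 0 p) => //= a s IH.
    by rewrite eints_cons IH enc_int0.
  by rewrite !ez; congr (_ ++ (_ ++ (_ ++ _))).
by rewrite -!catA.
Qed.

End TheLoop.

(** * Evaluating constraint rows on block vectors *)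

Definition dot p (r : seq int) (x : 'cV[int]_p) : int := \sum_(j < p) nth 0 r j * x j 0.

Lemma lecv_rows p q (cs : seq (seq int * int)) (x : 'cV[int]_q) : size cs = p ->
  lecv (mx_of_rows p q (map fst cs) *m x) (mx_of_rows p 1 (map (fun c => [:: c.2]) cs)) <->
  all (fun c => dot c.1 x <= c.2) cs.
Proof.
move=> sz.
have entry (i : 'I_p) : (mx_of_rows p q (map fst cs) *m x) i 0 = dot (nth ([::], 0) cs i).1 x.
  by rewrite mxE; apply: eq_bigr => j _; rewrite mxE (nth_map ([::], 0)) ?sz.
have bound (i : 'I_p) : mx_of_rows p 1 (map (fun c => [:: c.2]) cs) i 0 =
    (nth ([::], 0) cs i).2.
  by rewrite mxE (nth_map ([::], 0)) ?sz.
split=> [H|/(all_nthP ([::], 0)) H i].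
  apply/(all_nthP ([::], 0)) => i; rewrite sz => lt.
  by have := H (Ordinal lt); rewrite entry bound.
by rewrite entry bound; apply: H; rewrite sz.
Qed.

Lemma dot_cat p q A B (x : 'cV[int]_p) (y : 'cV[int]_q) : size A = p ->
  dot (A ++ B) (col_mx x y) = dot A x + dot B y.
Proof.
move=> szA; rewrite /dot big_split_ord /=; congr (_ + _); apply: eq_bigr => i _.
  by rewrite col_mxEu nth_cat szA ltn_ord.
by rewrite col_mxEd nth_cat szA ltnNge leq_addr /= addKn.
Qed.

Definition last3 (s t k : int) : 'cV[int]_3 := \col_i nth 0 [:: s; t; k] i.

Lemma dot_last3 a b c B s t k :
  dot (a :: b :: c :: B) (last3 s t k) = a * s + b * t + c * k.
Proof. by rewrite /dot !big_ord_recl big_ord0 !mxE /= addr0 !addrA. Qed.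

Lemma dot_nseq p c (Y : 'cV[int]_p) : dot (nseq p c) Y = c * \sum_i Y i 0.
Proof.
by rewrite /dot mulr_sumr; apply: eq_bigr => i _; rewrite nth_nseq ltn_ord.
Qed.

Lemma nth_unit_seq m c q j : nth 0 (unit_seq m c q) j = if j == q then c else 0.
Proof.
rewrite /unit_seq nth_cat size_nseq nth_nseq.
case: ltngtP => [lt|gt|->] //; last by rewrite subnn.
by rewrite -(subnSK gt) /= nth_nseq if_same.
Qed.

Lemma dot_unit_seq m c (i : 'I_m) (Y : 'cV[int]_m) : dot (unit_seq m c i) Y = c * Y i 0.
Proof.
rewrite /dot (bigD1 i) //= nth_unit_seq eqxx big1 ?addr0 // => j ne.
by rewrite nth_unit_seq val_eqE (negPf ne) mul0r.
Qed.

Lemma dot_opp p (f : nat -> int) (Y : 'cV[int]_p) :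
  dot (mkseq (fun i => - f i) p) Y = - dot (mkseq f p) Y.
Proof.
by rewrite /dot -sumrN; apply: eq_bigr => i _; rewrite !nth_mkseq // mulNr.
Qed.

(** * Loop runs and firing counts *)

Section Semantics.
Variables (m n : nat) (E : nat -> nat -> int).
Local Notation Lp := (vas_loop m n E).

Definition valuation (Y : 'cV[int]_m) (s t k : int) : 'cV[int]_(m + 3) :=
  col_mx Y (last3 s t k).

Lemma valuation_eta (x : 'cV[int]_(m + 3)) : exists Y s t k, x = valuation Y s t k.
Proof.
pose z := dsubmx x; exists (usubmx x), (z 0 0), (z 1 0), (z (inord 2) 0).
rewrite -[x in LHS]vsubmxK; congr col_mx; apply/colP => i.
rewrite [RHS]mxE -/z; case: i => [[|[|[|//]]] lt] /=; congr (z _ _); apply: val_inj => //=.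
by rewrite inordK.
Qed.

(* The current marking, from which the target is withdrawn when [t = -1]. *)
Definition marking (Y : 'cV[int]_m) (s t : int) (j : nat) : int :=
  dot (mkseq (fun i => E i j) m) Y + E m j * s + E m.+1 j * t.

Lemma dot_row6 A a b c B a' b' c' Y s t k Y' s' t' k' :
  size A = m -> size B = m ->
  dot (row6 A a b c B a' b' c') (col_mx (valuation Y s t k) (valuation Y' s' t' k')) =
  dot A Y + (a * s + b * t + c * k) + (dot B Y' + (a' * s' + b' * t' + c' * k')).
Proof.
move=> szA szB; rewrite /row6 catA dot_cat ?size_cat ?szA //.
by rewrite !dot_cat // !dot_last3.
Qed.

Lemma initialE Y s t k : initial (L := Lp) (valuation Y s t k) <-> Y = 0.
Proof.
have szp : size [seq (r, 0 : int) | r <- pre_rows m] = (m + m)%N.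
  by rewrite size_map size_cat !size_mkseq.
have -> : initial (L := Lp) (valuation Y s t k) <->
    all (fun c => dot c.1 (valuation Y s t k) <= c.2) [seq (r, 0) | r <- pre_rows m].
  rewrite -(lecv_rows _ szp) -!map_comp map_id_in // /initial /=.
  suff -> : [seq [:: 0] | _ <- pre_rows m] = nseq (m + m)%N [:: 0 : int] by [].
  by rewrite -szp size_map; elim: (pre_rows m) => //= r rs ->.
have dotp c (i : 'I_m) :
    dot (unit_seq m c i ++ [:: 0; 0; 0]) (valuation Y s t k) = c * Y i 0.
  rewrite dot_cat ?size_unit_seq // dot_unit_seq dot_last3 !mul0r !addr0 //.
rewrite all_map /pre_rows all_cat.
split=> [/andP[/allP H1 /allP H2]|Y0].
  apply/colP => i; rewrite mxE; apply/eqP; rewrite eq_le.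
  have mi : (i : nat) \in iota 0 m by rewrite mem_iota add0n ltn_ord.
  have := H1 _ (map_f _ mi); have := H2 _ (map_f _ mi); rewrite /= !dotp.
  by rewrite mul1r mulN1r oppr_le0 => -> ->.
apply/andP; split; apply/allP => r /mapP[q]; rewrite mem_iota add0n => /= lt ->;
  by move: (dotp 1 (Ordinal lt)) (dotp (-1) (Ordinal lt)) => /= d1 d2;
    rewrite ?d1 ?d2 Y0 mxE mulr0.
Qed.

Lemma transitionE Y s t k Y' s' t' k' :
  transition (L := Lp) (valuation Y s t k) (valuation Y' s' t' k') <->
  [/\ forall j, (j < n)%N -> 0 <= marking Y s t j <= k - k',
      forall i, Y i 0 <= Y' i 0,
      \sum_i Y' i 0 - \sum_i Y i 0 <= 1,
      s = 1 & [/\ -1 <= t <= 0, 0 <= k & 1 + t <= k - k']].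
Proof.
set x := valuation Y s t k; set x' := valuation Y' s' t' k'.
have -> : transition (L := Lp) x x' <->
    all (fun c => dot c.1 (col_mx x x') <= c.2) (constraints m n E).
  by split=> [[_ /(lecv_rows _ (size_constraints m n E))] //|H]; split; [case|apply/lecv_rows; rewrite ?size_constraints].
have szE sg j : size (mkseq (fun i => signed sg (E i j)) m) = m by rewrite size_mkseq.
have szZ c : size (nseq m (c : int)) = m by rewrite size_nseq.
have nonneg j : (dot (column_row m E true 0 0 j) (col_mx x x') <= 0) = (0 <= marking Y s t j).
  rewrite /column_row dot_row6 // dot_nseq (dot_opp (fun i => E i j)) -oppr_le0 /marking.
  by congr (_ <= _); rewrite /signed; ring.
have drop j : (dot (column_row m E false (-1) 1 j) (col_mx x x') <= 0) =
    (marking Y s t j <= k - k').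
  rewrite /column_row dot_row6 // dot_nseq -[RHS]subr_le0 /marking.
  by congr (_ <= _); rewrite /signed; ring.
have grow (i : 'I_m) : (dot (row6 (unit_seq m 1 i) 0 0 0 (unit_seq m (-1) i) 0 0 0)
    (col_mx x x') <= 0) = (Y i 0 <= Y' i 0).
  rewrite dot_row6 ?size_unit_seq // !dot_unit_seq -[RHS]subr_le0.
  by congr (_ <= _); ring.
have fixed : all (fun c => dot c.1 (col_mx x x') <= c.2) (fixed_constraints m) =
    [&& \sum_i Y' i 0 - \sum_i Y i 0 <= 1, s <= 1, - s <= -1, t <= 0, - t <= 1,
        t - k + k' <= -1 & - k <= 0].
  rewrite [all _ _]/= !dot_row6 // !dot_nseq andbT.
  by do ![congr (_ && _)]; congr (_ <= _); ring.
rewrite /constraints !all_cat fixed !all_map.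
split.
  move=> /and4P[/allP H1 /allP H2 /allP H3 /and5P[H4 H5 H6 H7 /and3P[H8 H9 H10]]].
  split.
  - move=> j lt; have mj : j \in iota 0 n by rewrite mem_iota.
    by rewrite -nonneg -drop; apply/andP; split; [apply: (H1 j mj) | apply: (H2 j mj)].
  - move=> i; have mi : (i : nat) \in iota 0 m by rewrite mem_iota add0n ltn_ord.
    by rewrite -grow; apply: (H3 _ mi).
  - by [].
  - by lia.
  - by split; lia.
move=> [H1 H2 H3 -> [H4 H5 H6]]; apply/and4P; split.
- by apply/allP => j; rewrite mem_iota add0n /= nonneg => /H1/andP[].
- by apply/allP => j; rewrite mem_iota add0n /= drop => /H1/andP[].
- by apply/allP => q; rewrite mem_iota add0n => /= lt; rewrite (grow (Ordinal lt)).
by rewrite H3; lia.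
Qed.

(* Firing counts of the runs of the vector addition system. *)
Inductive fires : 'cV[int]_m -> Prop :=
| fires_none : fires 0
| fires_one Y i : fires Y ->
    (forall j, (j < n)%N -> 0 <= marking (Y + delta_mx i 0) 1 0 j) ->
    fires (Y + delta_mx i 0).

Hypothesis src_ge0 : forall j, (j < n)%N -> 0 <= E m j.
Hypothesis tgt_ge0 : forall j, (j < n)%N -> 0 <= E m.+1 j.

Lemma fires_marking Y : fires Y -> forall j, (j < n)%N -> 0 <= marking Y 1 0 j.
Proof.
case=> // j lt; rewrite /marking /dot big1 => [|i _]; last by rewrite mxE mulr0.
by have := src_ge0 lt; lia.
Qed.

Lemma upper_bound (f : nat -> int) p : exists2 B, 0 <= B & forall j, (j < p)%N -> f j <= B.
Proof.
elim: p => [|p [B B0 HB]]; first by exists 0.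
exists (Num.max B (f p)) => [|j]; first by rewrite le_max B0.
by rewrite ltnS leq_eqVlt le_max => /orP[/eqP->|/HB ->] //; rewrite lexx orbT.
Qed.

Lemma sum_delta (i : 'I_m) : \sum_l (delta_mx i 0 : 'cV[int]_m) l 0 = 1.
Proof.
rewrite (bigD1 i) //= mxE !eqxx big1 ?addr0 // => l ne.
by rewrite mxE (negPf ne).
Qed.

(** The budget is computed backwards: the final value [k] is prescribed and the initial [K] is
    chosen to afford the whole run. Firing from [Y] costs at most [B + 1], where [B] bounds the
    marking and 1 is [1 + t]. *)
Lemma fires_run Y : fires Y -> forall k, 0 <= k -> exists2 K, 0 <= K &
  clos_refl_trans _ (transition (L := Lp)) (valuation 0 1 0 K) (valuation Y 1 0 k).
Proof.
elim=> [k k0|{}Y i FY IH _ k k0]; first by exists k => //; apply: rt_refl.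
have [B B0 HB] := upper_bound (marking Y 1 0) n.
have [|K K0 R] := IH (k + B + 1); first by lia.
exists K => //; apply: rt_trans R _; apply: rt_step; apply/transitionE.
split=> //.
- by move=> j lt; have := fires_marking FY lt; have := HB j lt; lia.
- by move=> l; rewrite !mxE lerDl ler0n.
- rewrite (eq_bigr (fun l => Y l 0 + (delta_mx i 0 : 'cV[int]_m) l 0)) => [|l _].
    by rewrite big_split /= sum_delta addrAC subrr add0r.
  by rewrite mxE.
by split; lia.
Qed.

Lemma no_LinRF Y : fires Y -> (forall j, (j < n)%N -> marking Y 1 (-1) j = 0) ->
  ~ has_LinRF Lp.
Proof.
move=> FY tgt [lam [lam0 H]].
have [B B0 HB] := upper_bound (marking Y 1 0) n.
(* [B + 1] pays for the step that withdraws the target, leaving [k = 0] at the state [z], which then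
   loops on itself. *)
have [|K K0 R] := fires_run FY (k := B + 1); first by lia.
pose z : 'cV[int]_(m + 3) := valuation Y 1 (-1) 0.
have [|_] := H z z; last by rewrite subrr ler10.
split.
  exists (valuation 0 1 0 K); first exact/initialE.
  apply: rt_trans R _; apply: rt_step; apply/transitionE; split=> //.
  - by move=> j lt; have := fires_marking FY lt; have := HB j lt; lia.
  - by rewrite subrr.
  by split; lia.
apply/transitionE; split=> //; first by move=> j /tgt ->.
by rewrite subrr.
Qed.

(** This is where integrality enters: over the rationals, several displacements could be fired
    fractionally in one step. *)
Lemma unit_or_zero (D : 'cV[int]_m) : (forall i, 0 <= D i 0) -> \sum_i D i 0 <= 1 ->
  D = 0 \/ exists i, D = delta_mx i 0.
Proof.
move=> D0 sumD; have [i Di|no] := pickP (fun i => D i 0 != 0); last first.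
  by left; apply/colP => i; rewrite mxE; apply/eqP/negbFE/no.
right; exists i; move: sumD; rewrite (bigD1 i) //=.
have S0 : 0 <= \sum_(l < m | l != i) D l 0 by apply: sumr_ge0.
move: S0 (@psumr_eq0P _ _ (fun l => l != i) (fun l => D l 0)) (D0 i) Di.
move: (\sum_(l < m | _) _) => S S0 HS Di0 Di1 sumD.
have D1 : D i 0 = 1 by lia.
have S00 : S = 0 by lia.
apply/colP => l; rewrite mxE andbT.
by case: eqP => [->|/eqP ne] //; rewrite (HS _ S00 l ne).
Qed.

(** Nonnegativity is tested when a state is left, not when it is entered. Hence the claim concerns
    states with an outgoing transition, and the last state of a run may violate it. *)
Lemma reachable_fires x0 x x' : initial (L := Lp) x0 ->
  clos_refl_trans _ (transition (L := Lp)) x0 x -> transition (L := Lp) x x' ->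
  fires (usubmx x).
Proof.
move=> I0 R; move: x'; elim: (clos_rt_rtn1 _ _ _ _ R) => {x R} [x' _|y z Ryz _ IH x' Rz].
  have [Y [s [t [k Ex]]]] := valuation_eta x0.
  by move: I0; rewrite Ex col_mxKu => /initialE ->; apply: fires_none.
have {IH} := IH _ Ryz; move: Ryz Rz.
have [Y [s [t [k ->]]]] := valuation_eta y; have [Y' [s' [t' [k' ->]]]] := valuation_eta z.
have [Y'' [s'' [t'' [k'' ->]]]] := valuation_eta x'.
rewrite !col_mxKu => /transitionE[_ YY' sumY _ _] /transitionE[mk _ _ s1 [tb _ _]] FY.
have [||D|[i D]] := unit_or_zero (D := Y' - Y).
- by move=> i; rewrite !mxE subr_ge0.
- by rewrite (eq_bigr (fun i => Y' i 0 - Y i 0)) ?sumrB // => i _; rewrite !mxE.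
- by rewrite (subr0_eq D).
have EY : Y' = Y + delta_mx i 0 by rewrite -D addrC subrK.
rewrite EY; apply: fires_one => // j lt; have /andP[] := mk j lt.
rewrite -EY /marking s1; have := tgt_ge0 lt; nia.
Qed.

Lemma has_LinRF_counter :
  ~ (exists2 Y, fires Y & forall j, (j < n)%N -> marking Y 1 (-1) j = 0) -> has_LinRF Lp.
Proof.
move=> no; pose c : 'I_(m + 3) := rshift m (inord 2).
exists (delta_mx 0 c), 0 => x x' [[x0 I0 R] T].
have := reachable_fires I0 R T; move: T {R}.
have affE Y s t k : affine (L := Lp) (delta_mx 0 c) 0 (valuation Y s t k) = k%:~R.
  rewrite /affine addr0 (bigD1 c) //= big1 => [|i ne]; last first.
    by rewrite mxE (negPf ne) andbF mul0r.
  by rewrite mxE !eqxx mul1r addr0 col_mxEd mxE inordK.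
have [Y [s [t [k ->]]]] := valuation_eta x; have [Y' [s' [t' [k' ->]]]] := valuation_eta x'.
rewrite !affE col_mxKu => /transitionE[mk _ _ s1 [tb k0 kk']] FY.
rewrite ler0z; split=> //; rewrite -intrB -[1]/(1%:~R) ler_int.
have [t0|t0] : t = 0 \/ t = -1 by lia.
  by move: kk'; rewrite t0 addr0.
(* If [k] drops by less than 1, then [0 <= x_j <= k - k'] forces every [x_j] to be 0, so [Y] would
   witness reachability. *)
apply: NNPP => lt1; apply: no; exists Y => // j lt.
by have := mk j lt; rewrite s1 t0; lia.
Qed.

End Semantics.

Lemma vas_loop_specified m n E : partially_specified (vas_loop m n E).
Proof.
exists [set i : 'I_(m + 3) | (i < m)%N], (fun _ => 0) => le_row ge_row.
have nthV (r : 'I_(m + m)) : preV (vas_loop m n E) r 0 = 0.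
  by rewrite mxE nth_nseq ltn_ord.
have entry c (q : nat) j : (q < m)%N ->
    nth 0 (unit_seq m c q ++ [:: 0; 0; 0]) j = if j == q then c else 0.
  move=> lt; rewrite nth_cat size_unit_seq // nth_unit_seq; case: ltnP => // le.
  rewrite (negPf (_ : j != q)); last by lia.
  by case: (j - m)%N => [|[|[|l]]] //=; rewrite nth_nil.
have le_rowP (i : 'I_m) : le_row (lshift m i) (lshift 3 i).
  split=> //; apply/rowP => j; rewrite !mxE nth_cat size_mkseq /= ltn_ord nth_mkseq //.
  by rewrite entry // -val_eqE /=; case: eqP.
have ge_rowP (i : 'I_m) : ge_row (rshift m i) (lshift 3 i).
  split; last by rewrite nthV oppr0.
  apply/rowP => j; rewrite !mxE nth_cat size_mkseq /= ltnNge leq_addr /= addKn nth_mkseq //.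
  by rewrite entry // -val_eqE /=; case: eqP => //; rewrite oppr0.
split=> [r|i].
  case: (split_ordP r) => i ->; exists (lshift 3 i); rewrite ?inE //=; first by left.
  by right.
rewrite inE => lt; have -> : i = lshift 3 (Ordinal lt) by apply: val_inj.
by split; [exists (lshift m (Ordinal lt)) | exists (rshift m (Ordinal lt))].
Qed.

(* The displacements, the source and the target, listed as [m + 2] rows. *)
Definition vas_entry (I : vas_instance) (i j : nat) : int :=
  if insub j is Some j' then
    if insub i is Some i' then vdisp I i' j'
    else if i == vnum I then (vsrc I 0 j')%:Z else (vtgt I 0 j')%:Z
  else 0.

(* In dimension 0 the number of displacements may be exponential in the size
   of the instance, and is ignored. *)
Definition vas_to_loop (I : vas_instance) : loop :=
  vas_loop (if vdim I is 0 then 0%N else vnum I) (vdim I) (vas_entry I).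

(** * Agreement with the vector addition system *)

Section Instance.
Variable I : vas_instance.
Local Notation n := (vdim I).
Local Notation m := (vnum I).
Local Notation E := (vas_entry I).

Lemma vas_entry_disp (i : 'I_m) (j : 'I_n) : E i j = vdisp I i j.
Proof. by rewrite /vas_entry !valK. Qed.

Lemma vas_entry_src (j : 'I_n) : E m j = (vsrc I 0 j)%:Z.
Proof. by rewrite /vas_entry valK insubN ?ltnn // eqxx. Qed.

Lemma vas_entry_tgt (j : 'I_n) : E m.+1 j = (vtgt I 0 j)%:Z.
Proof. by rewrite /vas_entry valK insubN -?leqNgt // gtn_eqF. Qed.

Lemma markingE (Y : 'cV[int]_m) t (j : 'I_n) :
  marking E Y 1 t j = (Y^T *m vdisp I) 0 j + (vsrc I 0 j)%:Z + (vtgt I 0 j)%:Z * t.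
Proof.
rewrite /marking vas_entry_src vas_entry_tgt mulr1; congr (_ + _ + _).
rewrite mxE; apply: eq_bigr => i _.
by rewrite nth_mkseq // vas_entry_disp mxE mulrC.
Qed.

Lemma marking_delta (Y : 'cV[int]_m) i t (j : 'I_n) :
  marking E (Y + delta_mx i 0) 1 t j = marking E Y 1 t j + vdisp I i j.
Proof.
rewrite !markingE linearD /= mulmxDl trmx_delta -rowE !mxE; ring.
Qed.

(** A marking is determined by its firing counts, and [fires] requires nonnegativity after each
    firing, so its derivations are the runs from the source; [t = -1] subtracts the target. *)
Lemma reachable_fires_iff :
  vas_reachable I <->
  exists2 Y, fires n E Y & forall j, (j < n)%N -> marking (m := m) E Y 1 (-1) j = 0.
Proof.
have m0 (Y : 'cV[int]_m) (j : 'I_n) :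
    marking E Y 1 (-1) j = marking E Y 1 0 j - (vtgt I 0 j)%:Z.
  by rewrite !markingE; ring.
split.
  move=> /clos_rt_rtn1_iff R.
  suff [Y FY HY] : exists2 Y, fires n E Y & forall j : 'I_n,
      marking (m := m) E Y 1 0 j = (vtgt I 0 j)%:Z.
    exists Y => // j lt; rewrite (m0 Y (Ordinal lt)) HY subrr //.
  elim: R => [|x x' [i Ex] _ [Y FY HY]].
    exists 0; first exact: fires_none.
    by move=> j; rewrite markingE trmx0 mul0mx mxE add0r mulr0 addr0.
  have Hi (j : 'I_n) : marking E (Y + delta_mx i 0) 1 0 j = (x' 0 j)%:Z.
    by rewrite marking_delta HY; have /rowP/(_ j) := Ex; rewrite !mxE => ->.
  exists (Y + delta_mx i 0) => //; apply: fires_one => // j lt.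
  by rewrite (Hi (Ordinal lt)).
move=> [Y FY HY].
suff [x R Hx] : exists2 x, clos_refl_trans _ (vas_step (vdisp I)) (vsrc I) x &
    forall j : 'I_n, marking E Y 1 0 j = (x 0 j)%:Z.
  rewrite /vas_reachable; suff <- : x = vtgt I by [].
  apply/rowP => j; have := HY j (ltn_ord j); rewrite m0 Hx; lia.
elim: FY {HY} => [|{}Y i _ [x R Hx] H].
  exists (vsrc I); first exact: rt_refl.
  by move=> j; rewrite markingE trmx0 mul0mx mxE add0r mulr0 addr0.
(* [absz] loses nothing here, since the marking is nonnegative by [H]. *)
pose x' : 'rV[nat]_n := \row_j absz (marking E (Y + delta_mx i 0) 1 0 j).
have Hx' (j : 'I_n) : marking E (Y + delta_mx i 0) 1 0 j = (x' 0 j)%:Z.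
  by rewrite mxE; have := H j (ltn_ord j); lia.
exists x' => //; apply: rt_trans R _; apply: rt_step; exists i.
by apply/rowP => j; rewrite !mxE -Hx -marking_delta Hx' mxE.
Qed.

Lemma vas_to_loop_correct : vas_reachable I <-> ~ has_LinRF (vas_to_loop I).
Proof.
have gen m' E' : (forall j, (j < n)%N -> 0 <= E' m' j) ->
    (forall j, (j < n)%N -> 0 <= E' m'.+1 j) ->
    ~ has_LinRF (vas_loop m' n E') <->
    exists2 Y, fires n E' Y & forall j, (j < n)%N -> marking (m := m') E' Y 1 (-1) j = 0.
  move=> src tgt; split=> [no|[Y FY HY]]; last exact: (no_LinRF src FY HY).
  by apply: NNPP => H; apply: no; apply: (has_LinRF_counter tgt H).
have src j : (j < n)%N -> 0 <= E m j.
  by move=> lt; rewrite (vas_entry_src (Ordinal lt)).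
have tgt j : (j < n)%N -> 0 <= E m.+1 j.
  by move=> lt; rewrite (vas_entry_tgt (Ordinal lt)).
have [n0|n_gt0] := posnP n; last first.
  rewrite /vas_to_loop (_ : (if n is 0 then 0%N else m) = m); last by case: n n_gt0.
  by rewrite gen // reachable_fires_iff.
(* In dimension 0 there is a single marking, so both sides hold. *)
have none j : (j < n)%N -> False by rewrite n0.
rewrite /vas_to_loop (_ : (if n is 0 then 0%N else m) = 0%N); last by rewrite n0.
rewrite gen; try by move=> j /none.
split=> _; first by exists 0 => [|j /none //]; apply: fires_none.
rewrite /vas_reachable (_ : vtgt I = vsrc I); first exact: rt_refl.
by apply/rowP => j; case: (none j).
Qed.

(** * The encoded instance and the running time *)

Definition vas_words : seq (seq symbol) :=
  [seq enc_int (E i j) | i <- iota 0 m.+2, j <- iota 0 n].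

Lemma enc_vas_words : enc_vas I = enc_nat n ++ enc_nat m ++ flatten vas_words.
Proof.
rewrite /enc_vas; congr (_ ++ (_ ++ _)).
rewrite /vas_words -addn2 iotaD map_cat flatten_cat flatten_cat /= cats0.
have row_words i (f : 'I_n -> int) : (forall j : 'I_n, E i j = f j) ->
    [seq enc_int (E i j) | j <- iota 0 n] = [seq enc_int (f j) | j <- enum 'I_n].
  by move=> H; rewrite -val_enum_ord -map_comp; apply: eq_map => j /=; rewrite H.
congr (_ ++ _).
  rewrite /enc_mx; congr (flatten (flatten _)).
  rewrite -[iota 0 m]val_enum_ord -map_comp; apply: eq_map => i /=.
  by rewrite (row_words _ (vdisp I i)) // => j; rewrite vas_entry_disp.
have enc_row (v : 'rV[nat]_n) :
    enc_mx (map_mx Posz v) = flatten [seq enc_int (v 0 j)%:Z | j <- enum 'I_n].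
  rewrite /enc_mx enum_ordSl enum_ord0 /= cats0; congr flatten.
  by apply: eq_map => j; rewrite mxE.
rewrite !enc_row flatten_cat add0n; congr (flatten _ ++ flatten _).
  by rewrite (row_words _ (fun j => (vsrc I 0 j)%:Z)) //; apply: vas_entry_src.
by rewrite (row_words _ (fun j => (vtgt I 0 j)%:Z)) //; apply: vas_entry_tgt.
Qed.

Lemma size_vas_words : size vas_words = (m.+2 * n)%N.
Proof. by rewrite size_allpairs !size_iota. Qed.

Lemma nth_vas_words i j : (i < m.+2)%N -> (j < n)%N ->
  nth [::] vas_words (i * n + j)%N = enc_int (E i j).
Proof.
move=> lti ltj; rewrite -[in RHS](add0n i) /vas_words; set js := iota 0 n.
have szj : size js = n by rewrite size_iota.
have nthj : nth 0%N js j = j by rewrite nth_iota.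
elim: m.+2 0%N i lti => // p IH a [|i] lti /=; rewrite nth_cat size_map szj.
  by rewrite mul0n add0n ltj (nth_map 0%N) ?szj // nthj addn0.
by rewrite ltnNge mulSn -addnA leq_addr /= addKn -addSnnS IH.
Qed.

(** Each word contains at least its [stop], so there are no more entries than symbols. This keeps
    the unary dimensions polynomial in the input length. *)
Lemma vas_size_bound : (m.+2 * n + size (flatten vas_words) <= 2 * size (enc_vas I))%N.
Proof.
have le : (m.+2 * n <= size (flatten vas_words))%N.
  rewrite -size_vas_words /vas_words.
  have pos : all (fun w => 0 < size w)%N vas_words.
    apply/allP => w /allpairsP[[i j] [_ _ ->]] /=.
    by have [s -> _] := enc_intP (E i j); rewrite size_rcons.
  rewrite -/vas_words; elim: vas_words pos => //= w ws IH /andP[w0 /IH].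
  by rewrite size_cat; lia.
by rewrite enc_vas_words !size_cat; lia.
Qed.

End Instance.

Lemma vas_to_loop_poly : poly_time_computable enc_vas enc_loop vas_to_loop.
Proof.
(* The constants 4 and 7: for [n > 0], [2 * (n + m) <= 2 * (m.+2 * n) <= 4 * N], and 7 is the number
   of fixed rows. *)
have [c [d H]] := poly_boundedP (poly_affine 4 7 poly_reductionT).
exists (machine reduction), c, d => I; set N := size (enc_vas I).
have Nb := vas_size_bound I; rewrite -/N in Nb.
have [||||s R out] := @hoare_reduction (vnum I) (vdim I) (4 * N + 7)
    (vas_words I) (vas_entry I).
- by rewrite size_vas_words; case: (vdim I) => // ; rewrite !muln0.
- by move=> i j lti ltj; apply: nth_vas_words => //; move: lti ltj; case: (vdim I).
- by lia.
- by move: Nb; case: (vdim I) => [|n]; nia.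
apply: (hoare_outputs (n := reductionT (4 * N + 7)) (s := s)).
- by rewrite enc_vas_words.
- by rewrite out /vas_to_loop enc_vas_loop.
exact: H.
Qed.

Theorem theorem4 :
  exists f : vas_instance -> loop,
    poly_time_computable enc_vas enc_loop f /\
    forall I : vas_instance,
      partially_specified (f I) /\
      (vas_reachable I <-> ~ has_LinRF (f I)).
Proof.
exists vas_to_loop; split; first exact: vas_to_loop_poly.
move=> I; split; [exact: vas_loop_specified | exact: vas_to_loop_correct].
Qed.
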